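(* Let $(G,d)$ be a metric space, $C\subset G$ a compact set, $(\mathbf X,\mathbb R,\mathbf X)$ a product triple, $\mu:\mathcal A\to[0,+\infty]$ a $\sigma$-finite regular measure, $\varphi:\mathbf X\to\mathbf X$ a convex function with $\varphi(0)=0$, and $f:G\to\mathbf X$ uniformly continuous on $G$ with $f(g)=0$ for all $g\in G\setminus C$. Let $h:G\to[0,+\infty)$ be a Lebesgue integrable function (with respect to $\mu$), bounded on each subset $B\subset G$ with $\mu(B)<+\infty$, and such that $$0<\int_Gh(g)\,d\mu(g)\le1.$$ Then $$\varphi\Big(\int_Gh(g)f(g)\,d\mu(g)\Big)\le\int_Gh(g)\,\varphi(f(g))\,d\mu(g).$$
   Context: Conventions. All vector lattices are Dedekind complete. For such a lattice $Y$: $Y^+=\{y\in Y:y\ge 0\}$, $|y|=y\vee(-y)$, $\overline Y^+=Y^+\cup\{+\infty\}$ with order and operations extended in the natural way and $0\cdot(+\infty)=0$. An $(o)$-sequence in $Y$ is a decreasing sequence in $Y^+$ with infimum $0$. ''Definitely'' means for all but finitely many $n$. The supremum of an empty family of positive elements is $0$. Convergences. A convergence on $Y$ is a pair $(\mathcal S,\ell)$, where $\mathcal S$ is a linear subspace of the space of all sequences in $Y$ and $\ell:\mathcal S\to Y$ satisfies: (a) $\ell$ is linear; (b) if $(x_n),(y_n)\in\mathcal S$ and $x_n\le y_n$ definitely, then $\ell((x_n))\le\ell((y_n))$; (c) if $x_n=c$ definitely then $(x_n)\in\mathcal S$ and $\ell((x_n))=c$; if $(x_n)\in\mathcal S$ and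 $x_n\ne y_n$ for only finitely many $n$, then $(y_n)\in\mathcal S$ and $\ell((y_n))=\ell((x_n))$; (d) if $(x_n)\in\mathcal S$ then $(|x_n|)\in\mathcal S$ and $\ell((|x_n|))=|\ell((x_n))|$; (e) if $(x_n),(z_n)\in\mathcal S$, $\ell((x_n))=\ell((z_n))$ and $x_n\le y_n\le z_n$ definitely, then $(y_n)\in\mathcal S$; (f) for $u\in Y^+$, $(\frac1n u)_n\in\mathcal S$ and $\ell((\frac1n u)_n)=0$. Writing $\ell((x_n)_n)=c$ means that $(x_n)_n$ is a sequence in $Y$ belonging to $\mathcal S$ and that the value of $\ell$ is $c$. Limit superior. Each convergence $(\mathcal S,\ell)$ comes with a map $\overline\ell$ from the set of sequences in $Y^+$ to $\overline Y^+$ such that: (a) $\overline\ell((x_n))=\overline\ell((y_n))$ if $x_n=y_n$ definitely; (b) $\overline\ell((x_n+y_n))\le\overline\ell((x_n))+\overline\ell((y_n))$; (c) if $x_n\le y_n$ definitely then $\overline\ell((x_n))\le\overline\ell((y_n))$; (d) $\overline\ell((x_n))=\ell((x_n))$ if $(x_n)\in\mathcal S$; (e) if $\overline\ell((x_n))=0$ then $(x_n)\in\mathcal S$ and $\ell((x_n))=0$. Product triples. $(Y_1,Y_2,Y)$, with convergences $\ell_1,\ell_2,\ell$ (and $\overline\ell_1,\overline\ell_2,\overline\ell$), is a product triple if there is a map $\cdot:Y_1\times Y_2\to Y$ with: (1),(2) additivity in each variable; (3) $x_1\ge y_1$ and $x_2\ge0$ imply $x_1\cdot x_2\ge y_1\cdot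 x_2$; (4) $x_1\ge0$ and $x_2\ge y_2$ imply $x_1\cdot x_2\ge x_1\cdot y_2$; (5) if $(x_n)$ is an $(o)$-sequence in $Y_1$ and $y\in Y_2^+$, then $(x_n\cdot y)$ is an $(o)$-sequence; (6) if $x\in Y_1^+$ and $(y_n)$ is an $(o)$-sequence in $Y_2$, then $(x\cdot y_n)$ is an $(o)$-sequence; (7) $\ell_1((x_n))=0$, $y\in Y_2$ imply $\ell((x_n\cdot y))=0$; (8) $x\in Y_1$, $\ell_2((y_n))=0$ imply $\ell((x\cdot y_n))=0$; (9) $x_n\in Y_1^+$, $\overline\ell_1((x_n))=x$, $y\in Y_2^+$ imply $\overline\ell((x_n\cdot y))=x\cdot y$; (10) $x\in Y_1^+$, $y_n\in Y_2^+$, $\overline\ell_2((y_n))=y$ imply $\overline\ell((x\cdot y_n))=x\cdot y$. $Y$ is a product algebra if $(Y,Y,Y)$ is a product triple. Setting. $\mathbf X$ is a product algebra with convergence $\ell$, $\mathbb R$ carries a convergence $\ell_{\mathbb R}$, $(\mathbb R,\mathbf X,\mathbf X)$ and $(\mathbf X,\mathbb R,\mathbf X)$ are product triples; products of reals with elements of $\mathbf X$ are scalar multiplication. $\mathcal A$ is the $\sigma$-algebra of Borel subsets of the metric space $G$. $\mu:\mathcal A\to[0,+\infty]$ (finitely additive) is $\sigma$-finite if $G=\bigcup_nB_n$ with $B_n\in\mathcal A$, $\mu(B_n)<+\infty$; it is regular if $\mu(K)<+\infty$ for every compact $K\subset G$ and for every $\varepsilon>0$, $E\in\mathcal A$ there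 are a compact $K\subset E$ and an open $U\supset E$ with $\mu(U\setminus K)\le\varepsilon$ (regular finitely additive measures are $\sigma$-additive). Integral of $\mathbf X$-valued functions. $f:G\to\mathbf X$ is simple if $f=\sum_{j=1}^rc_j\chi_{A_j}$ with $c_j\in\mathbf X$, $A_j\in\mathcal A$, $\mu(A_j)<+\infty$; $\int_Af\,d\mu=\sum_jc_j\,\mu(A\cap A_j)$. $(f_n)_n$ converges in $\mu$-measure to $f$ on $A$ if there are $A_n\in\mathcal A$ with $\ell_{\mathbb R}((\mu(A\cap A_n))_n)=0$ and $\ell\big(\big(\bigvee_{g\in A\setminus A_n}|f_n(g)-f(g)|\big)_n\big)=0$. The integrals of simple $f_n$ are $\mu$-equiabsolutely continuous if (i) $\ell((\int_{A_n}|f_n|\,d\mu)_n)=0$ whenever $\ell_{\mathbb R}((\mu(A_n))_n)=0$, $A_n\in\mathcal A$; (ii) there is an increasing sequence $(B_m)_m$ in $\mathcal A$ of sets of finite measure with $\ell\big(\big(\overline\ell((\int_{G\setminus B_m}|f_n|\,d\mu)_n)\big)_m\big)=0$. A sequence of simple functions is defining for $f$ if it converges in $\mu$-measure to $f$ on every $A\in\mathcal A$ of finite measure and has $\mu$-equiabsolutely continuous integrals. A positive $f$ is integrable if there are a defining sequence $(f_n)_n$ and $l:\mathcal A\to\mathbf X$ with $\ell\big(\big(\bigvee_{A\in\mathcal A}|\int_Af_n\,d\mu-l(A)|\big)_n\big)=0$, and then $\int_Af\,d\mu:=l(A)$ (independent of choices); a general $f$ is integrable if $f^\pm$ are, with $\int_Af\,d\mu=\int_Af^+\,d\mu-\int_Af^-\,d\mu$.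 Uniform continuity. $f:G\to\mathbf X$ is uniformly continuous on $G$ if there is $u\in\mathbf X^+$ such that for each $\varepsilon>0$ there is $\delta>0$ with $|f(g_1)-f(g_2)|\le\varepsilon u$ whenever $d(g_1,g_2)\le\delta$. Convexity. $\varphi:\mathbf X\to\mathbf X$ is convex if for each $v\in\mathbf X$ there is $\beta_v\in\mathbf X$ with $\varphi(s)\ge\varphi(v)+\beta_v\cdot(s-v)$ for all $s\in\mathbf X$, and such that for every $u\in\mathbf X^+\setminus\{0\}$ the set $\{\beta_v:v\in[-u,u]\}$ is order bounded in $\mathbf X$, where $[-u,u]=\{v\in\mathbf X:-u\le v\le u\}$. *)

(* Defs.v *)
From HB Require Import structures.
From mathcomp Require Import all_boot all_order all_algebra.
From mathcomp Require Import all_classical all_reals all_analysis.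

Set Implicit Arguments.
Unset Strict Implicit.
Unset Printing Implicit Defensive.

Import Order.TTheory GRing.Theory Num.Theory.
Import numFieldNormedType.Exports.

Local Open Scope classical_set_scope.
Local Open Scope ring_scope.

(* The order is the [<=] of [ring_scope].  The lattice structure is given by the
   join; meets are [- vjoin (- x) (- y)].  (Order.Lattice cannot be combined
   with Lmodule here: Hierarchy Builder would require new joins below
   Num.RealDomain.) *)
HB.mixin Record isDedekindVectorLattice (R : realType) X
    & Num.POrderedZmodule X & GRing.Lmodule R X := {
  vjoin : X -> X -> X ;
  vjoin_le : forall x y z : X, (vjoin x y <= z) = (x <= z) && (y <= z) ;
  dvl_lerD2r : forall z x y : X, x <= y -> x + z <= y + z ;
  dvl_scaler_ge0 : forall (a : R) (x : X), 0 <= a -> 0 <= x -> 0 <= a *: x ;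
  dvl_complete : forall A : set X, has_sup A -> supremums A !=set0
}.

#[short(type="dvlatticeType")]
HB.structure Definition DedekindVectorLattice (R : realType) :=
  { X of Num.POrderedZmodule X & GRing.Lmodule R X
       & isDedekindVectorLattice R X }.

HB.instance Definition _ (R : realType) := Order.POrder.copy R^o R.

Section RealVectorLattice.
Variable R : realType.

Fact real_vjoin_le (x y z : R^o) :
  (Num.max x y <= z) = (x <= z) && (y <= z).
Proof. by rewrite ge_max. Qed.

Fact real_dvl_lerD2r (z x y : R^o) : x <= y -> x + z <= y + z.
Proof. by rewrite lerD2r. Qed.

Fact real_dvl_scaler_ge0 (a : R) (x : R^o) : 0 <= a -> 0 <= x -> 0 <= a *: x.
Proof. exact: mulr_ge0. Qed.

Fact real_dvl_complete (A : set R^o) : has_sup A -> supremums A !=set0.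
Proof.
move=> hA; exists (sup (A : set R)); split.
  by apply/ubP => x Ax; exact: (@ub_le_sup R A hA.2 x Ax).
by apply/lbP => b bA; exact: (@ge_sup R A b hA.1 bA).
Qed.

HB.instance Definition _ := isDedekindVectorLattice.Build R R^o
  real_vjoin_le real_dvl_lerD2r real_dvl_scaler_ge0 real_dvl_complete.

End RealVectorLattice.

Section VectorLattice.
Variables (R : realType) (Y : dvlatticeType R).
Implicit Types (x y : Y) (u : nat -> Y).

Definition vabs x : Y := vjoin x (- x).
Definition vpos x : Y := vjoin x 0.
Definition vneg x : Y := vjoin (- x) 0.

Definition pos_seq u := forall n, 0 <= u n.

Definition o_sequence u :=
  [/\ pos_seq u, (forall n, u n.+1 <= u n) & infimums (range u) 0].

Definition order_bounded (A : set Y) := has_ubound A /\ has_lbound A.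

(* Y^+ together with +oo; positivity of the [Fin] values is required where the
   type is used. *)
Inductive ext : Type := Fin of Y | Infty.

Definition ext_le (a b : ext) : Prop :=
  match a, b with
  | Fin x, Fin y => x <= y
  | _, Infty => True
  | Infty, Fin _ => False
  end.

Definition ext_add (a b : ext) : ext :=
  match a, b with
  | Fin x, Fin y => Fin (x + y)
  | _, _ => Infty
  end.

End VectorLattice.
Arguments Infty {R Y}.

(* [cdom] is the space S of convergent sequences.  [clim] is meaningful on
   [cdom] only and [climsup] on sequences of positive elements only: the axioms
   say nothing about their values elsewhere.  "Definitely" is [\near \oo]. *)
Record convergence (R : realType) (Y : dvlatticeType R) := Convergence {
  cdom : set (nat -> Y) ;
  clim : (nat -> Y) -> Y ;
  climsup : (nat -> Y) -> ext Y ;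

  cdom_linear : forall (a : R) (x y : nat -> Y), cdom x -> cdom y ->
    cdom (fun n => a *: x n + y n) ;
  clim_linear : forall (a : R) (x y : nat -> Y), cdom x -> cdom y ->
    clim (fun n => a *: x n + y n) = a *: clim x + clim y ;
  clim_le : forall x y : nat -> Y, cdom x -> cdom y ->
    (\forall n \near \oo, x n <= y n) -> clim x <= clim y ;
  clim_near_cst : forall (c : Y) (x : nat -> Y),
    (\forall n \near \oo, x n = c) -> cdom x /\ clim x = c ;
  clim_near_eq : forall x y : nat -> Y, cdom x ->
    (\forall n \near \oo, x n = y n) -> cdom y /\ clim y = clim x ;
  clim_abs : forall x : nat -> Y, cdom x ->
    cdom (fun n => vabs (x n)) /\ clim (fun n => vabs (x n)) = vabs (clim x) ;
  cdom_squeeze : forall x y z : nat -> Y, cdom x -> cdom z ->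
    clim x = clim z -> (\forall n \near \oo, x n <= y n <= z n) -> cdom y ;
  (* sequences are indexed from 0, hence 1/(n+1) *)
  clim_harmonic : forall u : Y, 0 <= u ->
    cdom (fun n => n.+1%:R^-1 *: u) /\ clim (fun n => n.+1%:R^-1 *: u) = 0 ;

  climsup_ge0 : forall x : nat -> Y, pos_seq x -> ext_le (Fin 0) (climsup x) ;
  climsup_near_eq : forall x y : nat -> Y, pos_seq x -> pos_seq y ->
    (\forall n \near \oo, x n = y n) -> climsup x = climsup y ;
  climsup_add : forall x y : nat -> Y, pos_seq x -> pos_seq y ->
    ext_le (climsup (fun n => x n + y n)) (ext_add (climsup x) (climsup y)) ;
  climsup_le : forall x y : nat -> Y, pos_seq x -> pos_seq y ->
    (\forall n \near \oo, x n <= y n) -> ext_le (climsup x) (climsup y) ;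
  climsup_clim : forall x : nat -> Y, pos_seq x -> cdom x ->
    climsup x = Fin (clim x) ;
  climsup_eq0 : forall x : nat -> Y, pos_seq x -> climsup x = Fin 0 ->
    cdom x /\ clim x = 0
}.

Definition conv_to (R : realType) (Y : dvlatticeType R) (l : convergence Y)
    (x : nat -> Y) (c : Y) : Prop :=
  cdom l x /\ clim l x = c.

(* In the last two axioms the limit superior is an element of Y1 (resp. Y2), so
   that the product x . y is defined. *)
Record product_triple (R : realType) (Y1 Y2 Y : dvlatticeType R)
    (l1 : convergence Y1) (l2 : convergence Y2) (l : convergence Y)
    (mul : Y1 -> Y2 -> Y) : Prop := ProductTriple {
  ptDl : forall x1 y1 x2, mul (x1 + y1) x2 = mul x1 x2 + mul y1 x2 ;
  ptDr : forall x1 x2 y2, mul x1 (x2 + y2) = mul x1 x2 + mul x1 y2 ;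
  pt_le2r : forall x1 y1 x2, y1 <= x1 -> 0 <= x2 -> mul y1 x2 <= mul x1 x2 ;
  pt_le2l : forall x1 x2 y2, 0 <= x1 -> y2 <= x2 -> mul x1 y2 <= mul x1 x2 ;
  pt_o_seql : forall (x : nat -> Y1) y, o_sequence x -> 0 <= y ->
    o_sequence (fun n => mul (x n) y) ;
  pt_o_seqr : forall x (y : nat -> Y2), 0 <= x -> o_sequence y ->
    o_sequence (fun n => mul x (y n)) ;
  pt_conv0l : forall (x : nat -> Y1) y, conv_to l1 x 0 ->
    conv_to l (fun n => mul (x n) y) 0 ;
  pt_conv0r : forall x (y : nat -> Y2), conv_to l2 y 0 ->
    conv_to l (fun n => mul x (y n)) 0 ;
  pt_limsupl : forall (xs : nat -> Y1) x y, pos_seq xs ->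
    climsup l1 xs = Fin x -> 0 <= y ->
    climsup l (fun n => mul (xs n) y) = Fin (mul x y) ;
  pt_limsupr : forall x (ys : nat -> Y2) y, 0 <= x -> pos_seq ys ->
    climsup l2 ys = Fin y ->
    climsup l (fun n => mul x (ys n)) = Fin (mul x y)
}.

Section VectorIntegral.
Context d (T : measurableType d) (R : realType) (X : dvlatticeType R).
Variables (lR : convergence (R^o : dvlatticeType R)) (l : convergence X).
Variable mu : set T -> \bar R.
Implicit Types (A : set T) (f : T -> X) (fs : nat -> T -> X).

Definition simple_fun f : Prop :=
  exists (r : nat) (c : 'I_r -> X) (A : 'I_r -> set T),
    (forall j, measurable (A j) /\ (mu (A j) < +oo)%E) /\
    (forall t, f t = \sum_(j < r) (\1_(A j) t : R) *: c j).

(* The sum of c_j mu(A n A_j) for the canonical representation of the simple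
   function f, in which the c_j are the distinct nonzero values of f and
   A_j = {f = c_j}. *)
Definition simple_integral A f : X :=
  \sum_(c \in range f `\ 0) fine (mu (A `&` f @^-1` [set c])) *: c.

(* l((mu(A_n))_n) = 0; the measures must form a sequence of real numbers. *)
Definition measure_conv0 (As : nat -> set T) : Prop :=
  (forall n, (mu (As n) < +oo)%E) /\
  conv_to lR (fun n => fine (mu (As n)) : R^o) 0.

(* l((\/ D_n)_n) = 0 for families D_n of positive elements.  The suprema must
   exist in X; [supremum 0 set0] is 0. *)
Definition sup_conv0 (D : nat -> set X) : Prop :=
  (forall n, has_ubound (D n)) /\ conv_to l (fun n => supremum 0 (D n)) 0.

Definition conv_in_measure fs f A : Prop :=
  exists As : nat -> set T,
    [/\ forall n, measurable (As n),
        measure_conv0 (fun n => A `&` As n) &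
        sup_conv0 (fun n => [set vabs (fs n t - f t) | t in A `\` As n])].

Definition equi_abs_continuous fs : Prop :=
  (forall As : nat -> set T, (forall n, measurable (As n)) ->
     measure_conv0 As ->
     conv_to l (fun n => simple_integral (As n) (fun t => vabs (fs n t))) 0) /\
  (exists Bs : nat -> set T,
     [/\ forall m, measurable (Bs m) /\ (mu (Bs m) < +oo)%E,
         forall m, Bs m `<=` Bs m.+1 &
         exists s : nat -> X,
           (forall m, climsup l (fun n =>
              simple_integral (~` Bs m) (fun t => vabs (fs n t))) = Fin (s m)) /\
           conv_to l s 0]).

Definition defining_seq fs f : Prop :=
  [/\ forall n, simple_fun (fs n),
      forall A, measurable A -> (mu A < +oo)%E -> conv_in_measure fs f A &
      equi_abs_continuous fs].

Definition is_pos_integral f (I : set T -> X) : Prop :=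
  exists fs, defining_seq fs f /\
    sup_conv0 (fun n =>
      [set vabs (simple_integral A (fs n) - I A) | A in measurable]).

Definition vintegrable f : Prop :=
  (exists I, is_pos_integral (fun t => vpos (f t)) I) /\
  (exists I, is_pos_integral (fun t => vneg (f t)) I).

(* The value [I A] does not depend on the defining sequence nor on [I]. *)
Definition pos_integral A f : X :=
  xget 0 [set v | exists2 I, is_pos_integral f I & v = I A].

Definition vintegral A f : X :=
  pos_integral A (fun t => vpos (f t)) - pos_integral A (fun t => vneg (f t)).

End VectorIntegral.

(* The measurable types of the library are pointed. *)
#[short(type="pmetricType")]
HB.structure Definition PointedMetric (K : numDomainType) :=
  { M of Metric K M & isPointed M }.

Definition borel (R : realType) (G : pmetricType R) :=
  g_sigma_algebraType (@open G).

HB.instance Definition _ (R : realType) (G : pmetricType R) :=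
  Measurable.on (borel G).

Section MetricSpace.
Variables (R : realType) (G : pmetricType R).

Definition regular_measure (mu : set (borel G) -> \bar R) : Prop :=
  (forall K : set G, compact K -> (mu K < +oo)%E) /\
  (forall (e : R) (E : set (borel G)), 0 < e -> measurable E ->
     exists K U : set G,
       [/\ compact K, K `<=` E, open U, E `<=` U & (mu (U `\` K) <= e%:E)%E]).

Definition vunif_continuous (X : dvlatticeType R) (f : G -> X) : Prop :=
  exists2 u : X, 0 <= u &
    forall e : R, 0 < e -> exists2 delta : R, 0 < delta &
      forall g1 g2 : G, mdist g1 g2 <= delta -> vabs (f g1 - f g2) <= e *: u.

End MetricSpace.

Definition vconvex (R : realType) (X : dvlatticeType R) (mul : X -> X -> X)
    (phi : X -> X) : Prop :=
  exists beta : X -> X,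
    (forall v s, phi v + mul (beta v) (s - v) <= phi s) /\
    (forall u, 0 <= u -> u != 0 ->
       order_bounded [set beta v | v in [set v | - u <= v <= u]]).

(* Main.v *)
Require Import Defs.
From HB Require Import structures.
From mathcomp Require Import all_boot all_order all_algebra.
From mathcomp Require Import all_classical all_reals all_analysis.

Set Implicit Arguments.
Unset Strict Implicit.
Unset Printing Implicit Defensive.

Import Order.TTheory GRing.Theory Num.Theory.
Import numFieldNormedType.Exports.

Local Open Scope classical_set_scope.
Local Open Scope ring_scope.

(* Both h f and h phi(f) vanish outside the compact set C, which has finite
   measure.  On C, uniform continuity gives simple functions s_n = a_n f(x_n),
   with real steps 0 <= a_n <= h, within v/(n+1) of h f for a fixed v >= 0, and
   similarly s'_n = a_n phi(f(x_n)) for h phi(f), because phi is Lipschitz on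
   order intervals.  Uniform convergence on C makes h f and h phi(f) integrable,
   with the integrals of s_n and s'_n converging to V and W.  If p_j >= 0 are the
   weights of s_n, then sum_j p_j <= int h <= 1, and since phi(0) = 0 gives
   phi(V) <= beta_V . V, the subgradient inequality at V yields
   phi(V) + beta_V . (int s_n - V) <= int s'_n; let n tend to infinity. *)

(** * Dedekind complete vector lattices *)

(** The subgradient is taken at the limit [V] and not at the integral of [s_n]: [beta_V] is then
    fixed, and the axiom carrying null sequences through a product with a fixed factor justifies the
    passage to the limit. The steps [a_n] stay below [h] because this keeps the total weight below
    the integral of [h]. As [h] is merely measurable, it is discretised by its level sets and [f] by
    a finite net of C. The cells are the pairs (net cell, level), common to [s_n] and [s'_n], so
    that the same weights [p_j = mu(cell_j) a_j] stand on both sides of the finite inequality. Three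
    obstacles come from the definitions. The axioms of a convergence contain no completeness, so
    limits of integrals are produced as suprema, by Dedekind completeness. The value of [vintegral]
    is a choice, so its independence of the defining sequence is proved before it is computed. The
    product is only additive and monotone, so its compatibility with real scalars has to be
    derived. *)

Section VectorLatticeTheory.
Context {R : realType} {Y : dvlatticeType R}.
Implicit Types (x y z : Y) (a b : R).

Lemma dvl_lerD2l z x y : x <= y -> z + x <= z + y.
Proof. by rewrite ![z + _]addrC; exact: dvl_lerD2r. Qed.

Lemma dvl_lerD x y z t : x <= y -> z <= t -> x + z <= y + t.
Proof. by move=> xy zt; exact: le_trans (dvl_lerD2r _ _ _ xy) (dvl_lerD2l _ zt). Qed.

Lemma dvl_subr_ge0 x y : (0 <= y - x) = (x <= y).
Proof.
apply/idP/idP => [/(dvl_lerD2r x _ _)|/(dvl_lerD2r (- x) _ _)].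
  by rewrite add0r subrK.
by rewrite subrr.
Qed.

Lemma dvl_addr_ge0 x y : 0 <= x -> 0 <= y -> 0 <= x + y.
Proof. by move=> x0 y0; rewrite -[0]addr0; exact: dvl_lerD. Qed.

Lemma dvl_lerN2 x y : (- x <= - y) = (y <= x).
Proof. by rewrite -[LHS]dvl_subr_ge0 opprK addrC dvl_subr_ge0. Qed.

Lemma dvl_lerBlDr x y z : (x - y <= z) = (x <= z + y).
Proof. by rewrite -[LHS]dvl_subr_ge0 opprB addrA dvl_subr_ge0. Qed.

Lemma dvl_ler_wpZ a x y : 0 <= a -> x <= y -> a *: x <= a *: y.
Proof.
by move=> a0 xy; rewrite -dvl_subr_ge0 -scalerBr dvl_scaler_ge0// dvl_subr_ge0.
Qed.

Lemma dvl_ler_wZp a b x : a <= b -> 0 <= x -> a *: x <= b *: x.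
Proof.
by move=> ab x0; rewrite -dvl_subr_ge0 -scalerBl dvl_scaler_ge0// subr_ge0.
Qed.

Lemma dvl_ler_sum (I : Type) (r : seq I) (P : pred I) (F F' : I -> Y) :
  (forall i, P i -> F i <= F' i) ->
  \sum_(i <- r | P i) F i <= \sum_(i <- r | P i) F' i.
Proof. by move=> FF'; elim/big_ind2: _ => // *; exact: dvl_lerD. Qed.

Lemma dvl_sumr_ge0 (I : Type) (r : seq I) (P : pred I) (F : I -> Y) :
  (forall i, P i -> 0 <= F i) -> 0 <= \sum_(i <- r | P i) F i.
Proof. by move=> F0; elim/big_ind: _ => // *; exact: dvl_addr_ge0. Qed.

Lemma vjoin_ubl x y : x <= vjoin x y.
Proof. by have := lexx (vjoin x y); rewrite vjoin_le => /andP[]. Qed.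

Lemma vjoin_ubr x y : y <= vjoin x y.
Proof. by have := lexx (vjoin x y); rewrite vjoin_le => /andP[]. Qed.

Lemma vabs_le x z : (vabs x <= z) = (x <= z) && (- x <= z).
Proof. exact: vjoin_le. Qed.

Lemma vpos_le x z : (vpos x <= z) = (x <= z) && (0 <= z).
Proof. exact: vjoin_le. Qed.

Lemma ler_vabs x : x <= vabs x. Proof. exact: vjoin_ubl. Qed.
Lemma lerN_vabs x : - x <= vabs x. Proof. exact: vjoin_ubr. Qed.

(** Scale by 1/2. It serves where only the doubled inequality is visible, as in [0 <= vabs x]. *)
Lemma dvl_half_ge0 x : 0 <= x + x -> 0 <= x.
Proof.
move=> x0; have h : (0 : R) <= 2^-1 by rewrite invr_ge0.
have := dvl_scaler_ge0 _ _ h x0.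
by rewrite -[x in x + _]scale1r -[x in _ + x]scale1r -scalerDl scalerA -mulr2n
  mulVf ?scale1r// pnatr_eq0.
Qed.

Lemma vabs_ge0 x : 0 <= vabs x.
Proof.
apply: dvl_half_ge0; rewrite -{1}(subrr x).
by apply: dvl_lerD; [exact: ler_vabs|exact: lerN_vabs].
Qed.

Lemma vpos_ge0 x : 0 <= vpos x. Proof. exact: vjoin_ubr. Qed.
Lemma vpos_ge x : x <= vpos x. Proof. exact: vjoin_ubl. Qed.
Lemma vneg_ge0 x : 0 <= vneg x. Proof. exact: vjoin_ubr. Qed.

Lemma vabsN x : vabs (- x) = vabs x.
Proof.
by apply/le_anti; rewrite !vabs_le opprK ler_vabs lerN_vabs ler_vabs -{1}[x]opprK
  lerN_vabs.
Qed.

Lemma vabs_distC x y : vabs (x - y) = vabs (y - x).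
Proof. by rewrite -vabsN opprB. Qed.

Lemma ger0_vabs x : 0 <= x -> vabs x = x.
Proof.
move=> x0; apply/le_anti; rewrite vabs_le lexx ler_vabs /= andbT.
by rewrite (le_trans _ x0)// -oppr0 dvl_lerN2.
Qed.

Lemma vabs0 : vabs (0 : Y) = 0. Proof. exact: ger0_vabs. Qed.

Lemma ler_vabsD x y : vabs (x + y) <= vabs x + vabs y.
Proof. by rewrite vabs_le opprD !dvl_lerD ?ler_vabs ?lerN_vabs. Qed.

Lemma ler_vabs_dist z x y : vabs (x - y) <= vabs (x - z) + vabs (z - y).
Proof. by rewrite -[x - y](subrKA z) ler_vabsD. Qed.

Lemma ler_vabsZ a x : vabs (a *: x) <= `|a| *: vabs x.
Proof.
rewrite vabs_le; have [a0|a0] := lerP 0 a.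
  by rewrite ger0_norm// -scalerN !dvl_ler_wpZ ?ler_vabs ?lerN_vabs.
have a0' : 0 <= - a by rewrite oppr_ge0 ltW.
have -> : a *: x = (- a) *: - x by rewrite scaleNr scalerN opprK.
by rewrite ltr0_norm// -scalerN opprK !dvl_ler_wpZ ?ler_vabs ?lerN_vabs.
Qed.

Lemma ler_norm_vabs x z : (- z <= x <= z) = (vabs x <= z).
Proof.
by rewrite vabs_le andbC; congr (_ && _); rewrite -[RHS]dvl_lerN2 opprK.
Qed.

Lemma vnegE x : vneg x = vpos x - x.
Proof.
apply/le_anti; rewrite {1}/vneg vjoin_le dvl_subr_ge0 vpos_ge.
rewrite -{1}[- x]add0r dvl_lerD2r ?vpos_ge0//=.
rewrite dvl_lerBlDr vpos_le -dvl_lerBlDr subrr vneg_ge0/=.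
by rewrite -dvl_lerBlDr sub0r vjoin_ubl.
Qed.

Lemma vposBneg x : vpos x - vneg x = x.
Proof. by rewrite vnegE opprB addrC subrK. Qed.

(** This carries uniform approximations of a function over to its positive part. *)
Lemma vpos_dist x y : vabs (vpos x - vpos y) <= vabs (x - y).
Proof.
have H (u v : Y) : vpos u <= vabs (u - v) + vpos v.
  rewrite vpos_le dvl_addr_ge0 ?vabs_ge0 ?vpos_ge0// andbT.
  by rewrite -{1}[u](subrK v) dvl_lerD ?ler_vabs ?vpos_ge.
by rewrite vabs_le opprB !dvl_lerBlDr H vabs_distC H.
Qed.

Lemma vpos0 : vpos (0 : Y) = 0.
Proof. by apply/le_anti; rewrite vpos_ge0 vpos_le !lexx. Qed.

Lemma vpos_le_vabs x : vpos x <= vabs x.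
Proof. by rewrite vpos_le ler_vabs vabs_ge0. Qed.

Lemma supremum_ub (D : set Y) x : has_ubound D -> D x -> x <= supremum 0 D.
Proof.
move=> uD Dx; rewrite /supremum; case: ifPn => [/eqP D0|_].
  by have := Dx; rewrite D0.
have [z zD] : supremums D !=set0 by apply: dvl_complete; split => //; exists x.
by case: xgetP => [w _ [wD _]|/(_ z)//]; exact: wD.
Qed.

(** The condition [0 <= z] covers the empty [D], whose [supremum] is the default 0. *)
Lemma supremum_lub (D : set Y) z : has_ubound D -> 0 <= z -> ubound D z ->
  supremum 0 D <= z.
Proof.
move=> uD z0 Dz; rewrite /supremum; case: ifPn => // /set0P D0.
by case: xgetP => // w _ [_ wD]; exact: wD.
Qed.

Lemma supremum_ge0 (D : set Y) : has_ubound D -> (forall x, D x -> 0 <= x) ->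
  0 <= supremum 0 D.
Proof.
move=> uD D0; have [->|/set0P[x Dx]] := eqVneq D set0; first by rewrite supremum0.
exact: le_trans (D0 _ Dx) (supremum_ub uD Dx).
Qed.

End VectorLatticeTheory.

(** * Convergences and products *)

Lemma ext_le_trans (R : realType) (Y : dvlatticeType R) (a b c : ext Y) :
  ext_le a b -> ext_le b c -> ext_le a c.
Proof. by case: a b c => [x|] [y|] [z|] //=; exact: le_trans. Qed.

Lemma ext_add0 (R : realType) (Y : dvlatticeType R) (a : ext Y) :
  ext_add (Fin 0) a = a.
Proof. by case: a => //= x; rewrite add0r. Qed.

Section ConvergenceTheory.
Context {R : realType} {Y : dvlatticeType R} (l : convergence Y).
Implicit Types (x y : nat -> Y) (c e u : Y).

Lemma conv_cst c : conv_to l (fun=> c) c.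
Proof. by apply: clim_near_cst; near=> n. Unshelve. all: by end_near. Qed.

Lemma convDZ a x y c e : conv_to l x c -> conv_to l y e ->
  conv_to l (fun n => a *: x n + y n) (a *: c + e).
Proof.
move=> [dx <-] [dy <-]; split; [exact: cdom_linear|exact: clim_linear].
Qed.

Lemma convD x y c e : conv_to l x c -> conv_to l y e ->
  conv_to l (fun n => x n + y n) (c + e).
Proof.
move=> hx hy; have := convDZ 1 hx hy; rewrite scale1r.
by under eq_fun do rewrite scale1r.
Qed.

Lemma convZ a x c : conv_to l x c -> conv_to l (fun n => a *: x n) (a *: c).
Proof.
move=> hx; have := convDZ a hx (conv_cst 0); rewrite addr0.
by under eq_fun do rewrite addr0.
Qed.

Lemma convB x y c e : conv_to l x c -> conv_to l y e ->
  conv_to l (fun n => x n - y n) (c - e).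
Proof.
move=> hx hy; have := convDZ (-1) hy hx; rewrite scaleN1r addrC.
by under eq_fun do rewrite scaleN1r addrC.
Qed.

Lemma conv_to_le x y c e : conv_to l x c -> conv_to l y e ->
  (forall n, x n <= y n) -> c <= e.
Proof.
move=> [dx <-] [dy <-] xy; apply: clim_le => //.
by near=> n; exact: xy. Unshelve. all: by end_near. Qed.

(** Squeezing between [- y] and [y] yields membership in [cdom] only; the value 0 then follows from
    monotonicity of [clim]. *)
Lemma conv0_vabs_le x y : conv_to l y 0 -> (forall n, vabs (x n) <= y n) ->
  conv_to l x 0.
Proof.
move=> hy xy; have hNy := convB (conv_cst 0) hy; rewrite subr0 in hNy.
have xyP n : 0 - y n <= x n <= y n by rewrite sub0r ler_norm_vabs.
have dx : cdom l x.
  apply: (cdom_squeeze hNy.1 hy.1); first by rewrite hNy.2 hy.2.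
  by near=> n; exact: xyP.
split=> //; apply/le_anti/andP; split.
  by apply: (conv_to_le (conj dx erefl) hy) => n; have /andP[] := xyP n.
by apply: (conv_to_le hNy (conj dx erefl)) => n; have /andP[] := xyP n.
Unshelve. all: by end_near. Qed.

Lemma conv0_ge0_le x y : conv_to l y 0 -> (forall n, 0 <= x n) ->
  (forall n, x n <= y n) -> conv_to l x 0.
Proof. by move=> hy x0 xy; apply: conv0_vabs_le hy _ => n; rewrite ger0_vabs. Qed.

Lemma conv_harmonic u : conv_to l (fun n => n.+1%:R^-1 *: u) 0.
Proof.
have [] : conv_to l (fun n => n.+1%:R^-1 *: vabs u) 0.
  exact/clim_harmonic/vabs_ge0.
move=> d e; apply: conv0_vabs_le (conj d e) _ => n.
by rewrite (le_trans (ler_vabsZ _ _))// ger0_norm// invr_ge0.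
Qed.

(** The Archimedean property is read off the convergence: a constant sequence lies below a null
    sequence. *)
Lemma archimedean_le0 c u : (forall n, c <= n.+1%:R^-1 *: u) -> c <= 0.
Proof. exact: (conv_to_le (conv_cst c) (conv_harmonic u)). Qed.

End ConvergenceTheory.

Section ProductTheory.
Context {R : realType} {X : dvlatticeType R} {l : convergence X}.
Context {mul : X -> X -> X} (hmul : product_triple l l l mul).
Implicit Types (b x y : X).

Lemma mulv0 b : mul b 0 = 0.
Proof. by apply: (addrI (mul b 0)); rewrite -(ptDr hmul) !addr0. Qed.

Lemma mul0v x : mul 0 x = 0.
Proof. by apply: (addrI (mul 0 x)); rewrite -(ptDl hmul) !addr0. Qed.

Lemma mulvN b x : mul b (- x) = - mul b x.
Proof. by apply: (addrI (mul b x)); rewrite -(ptDr hmul) !subrr mulv0. Qed.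

Lemma mulNv b x : mul (- b) x = - mul b x.
Proof. by apply: (addrI (mul b x)); rewrite -(ptDl hmul) !subrr mul0v. Qed.

Lemma mulvB b x y : mul b (x - y) = mul b x - mul b y.
Proof. by rewrite (ptDr hmul) mulvN. Qed.

Lemma mulv_ge0 b x : 0 <= b -> 0 <= x -> 0 <= mul b x.
Proof. by move=> b0 x0; rewrite -(mulv0 b); exact: (pt_le2l hmul). Qed.

Lemma mulvMn b x n : mul b (n%:R *: x) = n%:R *: mul b x.
Proof.
elim: n => [|n IH]; first by rewrite !scale0r mulv0.
by rewrite -natr1 !scalerDl (ptDr hmul) IH !scale1r.
Qed.

(* Additivity gives rational scalars; monotonicity and the Archimedean property
   give real ones. *)
Lemma mulvZ a b x : mul b (a *: x) = a *: mul b x.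
Proof.
wlog b0 : b / 0 <= b.
  move=> H; rewrite -(vposBneg b) !(ptDl hmul) !mulNv !H ?vpos_ge0 ?vneg_ge0//.
  by rewrite scalerDr scalerN.
wlog x0 : x / 0 <= x.
  move=> H; rewrite -(vposBneg x) scalerBr !mulvB !H ?vpos_ge0 ?vneg_ge0//.
  by rewrite scalerBr.
wlog a0 : a / 0 <= a.
  move=> H; have [/H//|/ltW a0] := lerP 0 a.
  by rewrite -[a]opprK !(scaleNr (- a)) mulvN H// oppr_ge0.
have bx0 := mulv_ge0 b0 x0.
have H n : vabs (mul b (a *: x) - a *: mul b x) <= n.+1%:R^-1 *: mul b x.
  have N0 : (0 : R) < n.+1%:R by rewrite ltr0n.
  have NV0 : (0 : R) <= n.+1%:R^-1 by rewrite invr_ge0 ltW.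
  (* With k the integer part of (n+1)a, both (n+1) b(ax) and (n+1)a bx lie between k bx and (k+1)
     bx, so they differ by at most bx. *)
  have /andP[] := truncn_itv (mulr_ge0 (ltW N0) a0).
  set k := Num.trunc _ => kl ku.
  have E (y z : X) : n.+1%:R *: y <= n.+1%:R *: z + mul b x ->
      y - z <= n.+1%:R^-1 *: mul b x.
    move=> yz; rewrite dvl_lerBlDr addrC.
    have := dvl_ler_wpZ NV0 yz.
    by rewrite scalerDr !scalerA mulVf ?gt_eqF// !scale1r.
  rewrite vabs_le opprB; apply/andP; split; apply: E.
    apply: (@le_trans _ _ (k.+1%:R *: mul b x)).
      rewrite -!mulvMn scalerA; apply: (pt_le2l hmul) => //.
      exact: dvl_ler_wZp (ltW ku) x0.
    rewrite -natr1 scalerDl scale1r; apply: dvl_lerD => //.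
    by rewrite scalerA dvl_ler_wZp.
  rewrite scalerA; apply: (@le_trans _ _ (k.+1%:R *: mul b x)).
    exact: dvl_ler_wZp (ltW ku) bx0.
  rewrite -natr1 scalerDl scale1r; apply: dvl_lerD => //.
  rewrite -!mulvMn scalerA; apply: (pt_le2l hmul) => //.
  exact: dvl_ler_wZp kl x0.
apply/eqP; rewrite -subr_eq0; apply/eqP/le_anti.
by rewrite (le_trans (ler_vabs _) (archimedean_le0 l H)) -dvl_lerN2 oppr0
  (le_trans (lerN_vabs _) (archimedean_le0 l H)).
Qed.

Lemma mulv_sum b (J : finType) (m : J -> R) (x : J -> X) :
  mul b (\sum_j m j *: x j) = \sum_j m j *: mul b (x j).
Proof.
by elim/big_ind2: _ => [|x1 y1 x2 y2 <- <-|j _];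
  rewrite ?mulv0 ?(ptDr hmul) ?mulvZ.
Qed.

(* Twice the difference is [(c - b) (|x| + x) + (c + b) (|x| - x)]. *)
Lemma mulv_vabs_le b c x : vabs b <= c -> mul b x <= mul c (vabs x).
Proof.
rewrite vabs_le => /andP[bc Nbc].
rewrite -dvl_subr_ge0; apply: dvl_half_ge0.
have -> : mul c (vabs x) - mul b x + (mul c (vabs x) - mul b x) =
    mul (c - b) (vabs x + x) + mul (c + b) (vabs x - x).
  rewrite !(ptDl hmul) !(ptDr hmul) !mulNv !mulvN.
  rewrite [RHS]addrACA [X in _ = X + _]addrACA [X in _ = _ + X]addrACA.
  rewrite subrr addNr addr0 add0r.
  by rewrite addrACA.
apply: dvl_addr_ge0; apply: mulv_ge0.
- by rewrite dvl_subr_ge0.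
- by rewrite -{2}[x]opprK dvl_subr_ge0 lerN_vabs.
- by rewrite -{1}[b]opprK dvl_subr_ge0.
- by rewrite dvl_subr_ge0 ler_vabs.
Qed.

End ProductTheory.

(** * Integrals of simple functions *)

(* A simple function is represented as [c \o q], where the label [q] has values in
   a finite type and measurable fibres: finitely many simple functions then share
   one label, and their integrals become sums over the same index set. *)
Section FiniteLabels.
Context d (T : measurableType d) (R : realType).
Variable mu : {content set T -> \bar R}.
Implicit Types (A B : set T).

Definition measurable_label (J : finType) (q : T -> J) :=
  forall j, measurable (q @^-1` [set j]).

Definition fine_fibre (J : finType) (q : T -> J) A j :=
  fine (mu (A `&` q @^-1` [set j])).

Lemma measurable_label_pred (J : finType) (q : T -> J) (P : pred J) :
  measurable_label q -> measurable (q @^-1` [set j | P j]).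
Proof.
move=> mq; have -> : q @^-1` [set j | P j] =
    \bigcup_(j in [set j | P j]) q @^-1` [set j].
  by apply/seteqP; split => [t ?|t [j Pj /= ->//]]; exists (q t).
by apply: fin_bigcup_measurable => [|j _]; [exact: finite_finset|exact: mq].
Qed.

Lemma measurable_label_pair (J K : finType) (q : T -> J) (p : T -> K) :
  measurable_label q -> measurable_label p ->
  measurable_label (fun t => (q t, p t)).
Proof.
move=> mq mp [j k]; have := measurableI _ _ (mq j) (mp k).
by congr measurable; apply/seteqP; split => t /= [-> ->].
Qed.

(** The label of a point is its membership vector; the fibres are the cells of the partition
    generated by the [A i], finite intersections of these sets and their complements. *)
Lemma measurable_label_sets (r : nat) (A : 'I_r -> set T) :
  (forall i, measurable (A i)) ->
  measurable_label (fun t => [ffun i => t \in A i]).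
Proof.
move=> mA b; have -> : (fun t => [ffun i => t \in A i]) @^-1` [set b] =
    \bigcap_(i in [set: 'I_r]) (if b i then A i else ~` A i).
  apply/seteqP; split => [t /= <- i _|t tb].
    by rewrite ffunE; case: ifPn => [/set_mem|/negP h Ai] //; exact/h/mem_set.
  apply/ffunP => i; rewrite ffunE; have := tb i I.
  by case: ifPn => [_ /mem_set->//|_ tA]; apply/negbTE/negP => /set_mem.
apply: fin_bigcap_measurable => [|i _]; first exact: finite_finset.
by case: ifPn => _ //; exact: measurableC.
Qed.

Lemma content_lty_sub A B : measurable A -> measurable B -> A `<=` B ->
  (mu B < +oo)%E -> (mu A < +oo)%E.
Proof. by move=> mA mB AB; apply: le_lt_trans; apply: le_measure; rewrite ?inE. Qed.

Lemma content_fin_num A : (mu A < +oo)%E -> mu A \is a fin_num.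
Proof. by move=> ?; rewrite ge0_fin_numE. Qed.

Lemma fine_fibre_ge0 (J : finType) (q : T -> J) A j : 0 <= fine_fibre q A j.
Proof. exact/fine_ge0. Qed.

Lemma fine_fibre_eq0 (J : finType) (q : T -> J) A j :
  (forall t, A t -> q t != j) -> fine_fibre q A j = 0.
Proof.
move=> Aj; rewrite /fine_fibre (_ : _ `&` _ = set0) ?measure0//.
by apply/seteqP; split => // t [/Aj/eqP].
Qed.

Lemma content_label (J : finType) (q : T -> J) A (P : pred J) :
  measurable_label q -> measurable A ->
  mu (A `&` q @^-1` [set j | P j]) = (\sum_(j | P j) mu (A `&` q @^-1` [set j]))%E.
Proof.
move=> mq mA; have -> : A `&` q @^-1` [set j | P j] =
    \bigcup_(j in [set j | P j]) (A `&` q @^-1` [set j]).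
  by apply/seteqP; split => [t [At ?]|t [j Pj [At /= ->//]]]; exists (q t).
rewrite measure_fin_bigcup//; last 3 first.
- exact: finite_finset.
- exact: trivIset_preimage1_in.
- by move=> j _; exact: measurableI.
have -> : [set j | P j] = [set` [seq j <- index_enum J | P j]].
  by apply/seteqP; split => j /=; rewrite mem_filter mem_index_enum andbT.
by rewrite -fsbig_seq ?filter_uniq ?index_enum_uniq// big_filter.
Qed.

Lemma fine_content_label (J : finType) (q : T -> J) A (P : pred J) :
  measurable_label q -> measurable A ->
  (forall j, P j -> (mu (A `&` q @^-1` [set j]) < +oo)%E) ->
  fine (mu (A `&` q @^-1` [set j | P j])) = \sum_(j | P j) fine_fibre q A j.
Proof.
move=> mq mA fA; rewrite content_label// sum_fine// => j /fA.
exact: content_fin_num.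
Qed.

Lemma fine_contentU A B : measurable A -> measurable B -> A `&` B = set0 ->
  (mu A < +oo)%E -> (mu B < +oo)%E ->
  fine (mu (A `|` B)) = fine (mu A) + fine (mu B).
Proof. by move=> *; rewrite measureU// fineD// content_fin_num. Qed.

Lemma le_fine_content A B : measurable A -> measurable B -> A `<=` B ->
  (mu B < +oo)%E -> fine (mu A) <= fine (mu B).
Proof.
move=> mA mB AB fB; have fA := content_lty_sub mA mB AB fB.
by rewrite fine_le ?content_fin_num ?le_measure ?inE.
Qed.

Lemma contentU_le A B : measurable A -> measurable B ->
  (mu (A `|` B) <= mu A + mu B)%E.
Proof.
move=> mA mB; have -> : A `|` B = A `|` (B `\` A).
  by rewrite setDE setUIr setUCr setIT.
have mBA : measurable (B `\` A) by exact: measurableD.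
rewrite measureU//; last by rewrite setDE setICA setICr setI0.
by apply: leeD => //; apply: le_measure; rewrite ?inE// => t [].
Qed.

Lemma contentU_lty A B : measurable A -> measurable B ->
  (mu A < +oo)%E -> (mu B < +oo)%E -> (mu (A `|` B) < +oo)%E.
Proof.
by move=> mA mB fA fB; apply: le_lt_trans (contentU_le mA mB) (lte_add_pinfty _ _).
Qed.

Lemma fine_contentU_le A B : measurable A -> measurable B ->
  (mu A < +oo)%E -> (mu B < +oo)%E ->
  fine (mu (A `|` B)) <= fine (mu A) + fine (mu B).
Proof.
move=> mA mB fA fB; have fU := contentU_lty mA mB fA fB.
by rewrite -fineD ?content_fin_num// fine_le ?fin_numD ?content_fin_num ?contentU_le.
Qed.

End FiniteLabels.

Section SimpleIntegral.
Context d (T : measurableType d) (R : realType) (X : dvlatticeType R).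
Variable mu : {content set T -> \bar R}.
Implicit Types (A B C : set T) (f g : T -> X).

(** Fibres on which the function is 0 may have infinite measure; their terms are killed by the
    factor 0. *)
Definition finite_label (J : finType) (q : T -> J) (c : J -> X) :=
  forall j, c j != 0 -> (mu (q @^-1` [set j]) < +oo)%E.

Lemma finite_labelI (J : finType) (q : T -> J) (c : J -> X) A j :
  measurable_label q -> finite_label q c -> measurable A -> c j != 0 ->
  (mu (A `&` q @^-1` [set j]) < +oo)%E.
Proof.
move=> mq fq mA cj.
by apply: content_lty_sub (fq _ cj) => //; exact: measurableI.
Qed.

(** [simple_integral] groups points by value, the right-hand side by label. The fibre of a nonzero
    value is the disjoint union of the fibres of its labels, all of finite measure, so finite
    additivity survives [fine] and merges the terms. *)
Lemma simple_integral_label (J : finType) (q : T -> J) (c : J -> X) A :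
  measurable_label q -> finite_label q c -> measurable A ->
  simple_integral mu A (c \o q) = \sum_j fine_fibre mu q A j *: c j.
Proof.
move=> mq fq mA; rewrite /simple_integral.
rewrite (fsbig_fwiden (undup (codom c))) ?undup_uniq//; last 2 first.
- by move=> _ [[t _ <-] _] /=; rewrite mem_undup codom_f.
- move=> x [_ /= Nx]; have [->|x0] := eqVneq x 0; first by rewrite scaler0.
  rewrite (_ : _ `&` _ = set0) ?measure0 ?scale0r//.
  apply/seteqP; split => // t [_ /= qx]; apply: Nx; split; first by exists t.
  exact/eqP.
transitivity (\sum_(x <- undup (codom c)) \sum_(j | c j == x)
    fine_fibre mu q A j *: c j).
  apply: eq_bigr => x _; have [->|x0] := eqVneq x 0.
    by rewrite scaler0 big1// => j /eqP ->; rewrite scaler0.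
  have -> : (c \o q) @^-1` [set x] = q @^-1` [set j | c j == x].
    by apply/seteqP; split => t /eqP.
  rewrite fine_content_label// => [|j /eqP cj]; last first.
    by apply: finite_labelI fq _ _ => //; rewrite cj.
  by rewrite scaler_suml; apply: eq_bigr => j /eqP ->.
rewrite (exchange_big_dep xpredT)//=; apply: eq_bigr => j _.
transitivity (\sum_(x <- [:: c j]) fine_fibre mu q A j *: c j); last first.
  by rewrite big_seq1.
rewrite -big_filter; apply: perm_big; apply: uniq_perm => [||x];
  rewrite ?filter_uniq ?undup_uniq//.
rewrite mem_filter inE mem_undup eq_sym; case: eqVneq => //= ->.
by rewrite codom_f.
Qed.

Lemma simple_funP f : simple_fun mu f <->
  exists (J : finType) (q : T -> J) (c : J -> X),
    [/\ measurable_label q, finite_label q c & f = c \o q].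
Proof.
split.
  move=> [r [c [A [mA fE]]]].
  exists {ffun 'I_r -> bool}, (fun t => [ffun i => t \in A i]).
  exists (fun b : {ffun 'I_r -> bool} => \sum_(i < r) (b i)%:R *: c i); split.
  - by apply: measurable_label_sets => i; have [] := mA i.
  - move=> b b0.
    have [i bi] : exists i, b i.
      apply/existsP; apply: contraNT b0 => /existsPn b0.
      by rewrite big1// => i _; rewrite (negbTE (b0 i)) scale0r.
    have [mAi fAi] := mA i; apply: content_lty_sub fAi => //.
      by apply: measurable_label_sets => k; have [] := mA k.
    by move=> t /= /ffunP/(_ i); rewrite ffunE bi => /set_mem.
  - apply/funext => t; rewrite fE /=; apply: eq_bigr => i _.
    by rewrite ffunE indicE.
move=> [J [q [c [mq fq ->]]]].
(* Labels of value 0 receive the empty set, since their fibres may have infinite measure. *)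
exists #|J|, (fun i => c (enum_val i)), (fun i =>
  if c (enum_val i) == 0 then set0 else q @^-1` [set enum_val i]); split.
  move=> i; case: ifPn => [_|ci]; first by rewrite measure0; split.
  by split; [exact: mq|exact: fq].
move=> t /=; rewrite -(big_enum_val (A := J) (fun j =>
  \1_(if c j == 0 then set0 else q @^-1` [set j]) t *: c j)).
rewrite (bigD1 (q t))//= big1 ?addr0 => [|j jqt].
  case: eqVneq => [->|_]; first by rewrite scaler0.
  by rewrite indicE mem_set// scale1r.
case: ifPn => _; first by rewrite indic0 scale0r.
by rewrite indicE memNset ?scale0r//= => qtj; rewrite qtj eqxx in jqt.
Qed.

(** The pair of labels is a common refinement. Through it, linearity and monotonicity of the
    integral become termwise statements. *)
Lemma simple_fun_pairP f g : simple_fun mu f -> simple_fun mu g ->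
  exists (J : finType) (q : T -> J) (c e : J -> X),
    [/\ measurable_label q, finite_label q c, finite_label q e,
        f = c \o q & g = e \o q].
Proof.
move=> /simple_funP[J [q [c [mq fq ->]]]] /simple_funP[K [p [e [mp fp ->]]]].
have mqp := measurable_label_pair mq mp.
exists (J * K)%type, (fun t => (q t, p t)), (c \o fst), (e \o snd).
split => // -[j k] /= h.
  by apply: content_lty_sub (fq _ h) => // t /= [].
by apply: content_lty_sub (fp _ h) => // t /= [].
Qed.

Lemma finite_label_map2 (J : finType) (q : T -> J) (c e : J -> X)
    (op : X -> X -> X) : op 0 0 = 0 -> finite_label q c -> finite_label q e ->
  finite_label q (fun j => op (c j) (e j)).
Proof.
move=> op0 fc fe j; have [cj|/fc//] := eqVneq (c j) 0.
by have [ej|/fe//] := eqVneq (e j) 0; rewrite cj ej op0 eqxx.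
Qed.

Lemma simple_fun_map2 (op : X -> X -> X) f g : op 0 0 = 0 ->
  simple_fun mu f -> simple_fun mu g -> simple_fun mu (fun t => op (f t) (g t)).
Proof.
move=> op0 sf sg.
have [J [q [c [e [mq fc fe -> ->]]]]] := simple_fun_pairP sf sg.
by apply/simple_funP; exists J, q, (fun j => op (c j) (e j)); split => //;
  exact: finite_label_map2.
Qed.

Lemma simple_fun_map (op : X -> X) f : op 0 = 0 ->
  simple_fun mu f -> simple_fun mu (op \o f).
Proof. by move=> op0 sf; exact: (simple_fun_map2 (op := fun x _ => op x) op0 sf sf). Qed.

Lemma simple_funB f g : simple_fun mu f -> simple_fun mu g ->
  simple_fun mu (fun t => f t - g t).
Proof. exact: (simple_fun_map2 (op := fun x y => x - y) (subr0 0)). Qed.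

Lemma simple_fun_vabs f : simple_fun mu f -> simple_fun mu (fun t => vabs (f t)).
Proof. exact: (simple_fun_map vabs0). Qed.

Lemma simple_integral_eq0 f A : (forall t, A t -> f t = 0) ->
  simple_integral mu A f = 0.
Proof.
move=> f0; apply: fsbig1 => x [_ /= x0].
rewrite (_ : _ `&` _ = set0) ?measure0 ?scale0r//.
by apply/seteqP; split => // t [/= /f0 -> x0']; exact: x0.
Qed.

Lemma simple_integralDZ a f g A : simple_fun mu f -> simple_fun mu g ->
  measurable A -> simple_integral mu A (fun t => a *: f t + g t) =
    a *: simple_integral mu A f + simple_integral mu A g.
Proof.
move=> sf sg mA.
have [J [q [c [e [mq fc fe -> ->]]]]] := simple_fun_pairP sf sg.
rewrite (@simple_integral_label _ q (fun j => a *: c j + e j))//; last first.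
  apply: (finite_label_map2 (op := fun x y => a *: x + y)) => //.
  by rewrite scaler0 addr0.
rewrite !simple_integral_label// scaler_sumr -big_split.
by apply: eq_bigr => j _; rewrite scalerDr !scalerA mulrC.
Qed.

Lemma simple_integralD f g A : simple_fun mu f -> simple_fun mu g ->
  measurable A -> simple_integral mu A (fun t => f t + g t) =
    simple_integral mu A f + simple_integral mu A g.
Proof.
move=> sf sg mA; have := simple_integralDZ 1 sf sg mA; rewrite scale1r => <-.
by under [in RHS]eq_fun do rewrite scale1r.
Qed.

Lemma simple_integralB f g A : simple_fun mu f -> simple_fun mu g ->
  measurable A -> simple_integral mu A (fun t => f t - g t) =
    simple_integral mu A f - simple_integral mu A g.
Proof.
move=> sf sg mA; have := simple_integralDZ (-1) sg sf mA.
rewrite scaleN1r addrC => <-.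
by under [in RHS]eq_fun do rewrite scaleN1r addrC.
Qed.

Lemma le_simple_integral f g A : simple_fun mu f -> simple_fun mu g ->
  measurable A -> (forall t, A t -> f t <= g t) ->
  simple_integral mu A f <= simple_integral mu A g.
Proof.
move=> sf sg mA fg.
have [J [q [c [e [mq fc fe fE gE]]]]] := simple_fun_pairP sf sg.
rewrite fE gE !simple_integral_label//; apply: dvl_ler_sum => j _.
have [[t [At <-]]|Nj] := pselect (exists t, A t /\ q t = j).
  apply: dvl_ler_wpZ; first exact: fine_fibre_ge0.
  by have := fg _ At; rewrite fE gE.
rewrite fine_fibre_eq0 ?scale0r// => t At; apply/eqP => qt.
by apply: Nj; exists t.
Qed.

Lemma simple_integral_ge0 f A : simple_fun mu f -> measurable A ->
  (forall t, A t -> 0 <= f t) -> 0 <= simple_integral mu A f.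
Proof.
move=> sf mA f0; rewrite -(@simple_integral_eq0 (fun=> 0) A)//.
apply: le_simple_integral => //.
by have := @simple_fun_map (fun=> 0) f erefl sf.
Qed.

Lemma vabs_simple_integral_le f A : simple_fun mu f -> measurable A ->
  vabs (simple_integral mu A f) <= simple_integral mu A (fun t => vabs (f t)).
Proof.
move=> sf mA; have sfa := simple_fun_vabs sf.
have sN : simple_fun mu (fun t => - f t).
  by apply: (simple_fun_map (op := fun x => - x)) => //; rewrite oppr0.
have s0 : simple_fun mu (fun=> 0 : X).
  by have := @simple_fun_map (fun=> 0) f erefl sf.
rewrite vabs_le; apply/andP; split.
  by apply: le_simple_integral => // t _; exact: ler_vabs.
rewrite -[X in X <= _]sub0r -{1}(@simple_integral_eq0 (fun=> 0) A)//.
rewrite -simple_integralB//; apply: le_simple_integral => //.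
  exact: simple_funB.
by move=> t _; rewrite sub0r lerN_vabs.
Qed.

Lemma simple_integral_vabsB_le f g A : simple_fun mu f -> simple_fun mu g ->
  measurable A -> simple_integral mu A (fun t => vabs (f t - g t)) <=
    simple_integral mu A (fun t => vabs (f t)) +
    simple_integral mu A (fun t => vabs (g t)).
Proof.
move=> sf sg mA; have sf' := simple_fun_vabs sf; have sg' := simple_fun_vabs sg.
rewrite -simple_integralD//; apply: le_simple_integral => //.
- exact/simple_fun_vabs/simple_funB.
- exact: (simple_fun_map2 (op := +%R) (addr0 0)).
- by move=> t _; rewrite -[vabs (g t)]vabsN ler_vabsD.
Qed.

Lemma simple_integral_setU f A B : simple_fun mu f -> measurable A ->
  measurable B -> A `&` B = set0 ->
  simple_integral mu (A `|` B) f =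
    simple_integral mu A f + simple_integral mu B f.
Proof.
move=> /simple_funP[J [q [c [mq fq ->]]]] mA mB AB0.
have mAB : measurable (A `|` B) by exact: measurableU.
rewrite !simple_integral_label// -big_split/=; apply: eq_bigr => j _.
have [->|cj] := eqVneq (c j) 0; first by rewrite !scaler0 addr0.
rewrite -scalerDl; congr (_ *: _); rewrite /fine_fibre setIUl fine_contentU//.
- exact: measurableI.
- exact: measurableI.
- by rewrite setIACA AB0 set0I.
- exact: finite_labelI fq mA cj.
- exact: finite_labelI fq mB cj.
Qed.

Lemma simple_integral_setID f A B : simple_fun mu f -> measurable A ->
  measurable B -> simple_integral mu A f =
    simple_integral mu (A `&` B) f + simple_integral mu (A `\` B) f.
Proof.
move=> sf mA mB; rewrite -simple_integral_setU ?setUIDK//.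
- exact: measurableI.
- exact: measurableD.
- by rewrite setDE setIACA setICr setI0.
Qed.

Lemma le_simple_integral_set f A B : simple_fun mu f -> measurable A ->
  measurable B -> A `<=` B -> (forall t, B t -> 0 <= f t) ->
  simple_integral mu A f <= simple_integral mu B f.
Proof.
move=> sf mA mB AB f0; rewrite (simple_integral_setID sf mB mA).
have -> : B `&` A = A by exact/setIidPr.
rewrite -{1}[simple_integral mu A f]addr0 dvl_lerD2l//.
apply: simple_integral_ge0 => //; first exact: measurableD.
by move=> t [/f0].
Qed.

(** Labels of value 0 contribute to the right-hand side too. Since [A] has finite measure, [mu A]
    splits over all fibres and the terms compare one by one. *)
Lemma simple_integral_le_cst f A w : simple_fun mu f -> measurable A ->
  (mu A < +oo)%E -> (forall t, A t -> f t <= w) ->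
  simple_integral mu A f <= fine (mu A) *: w.
Proof.
move=> /simple_funP[J [q [c [mq fq fE]]]] mA fA fw.
have -> : mu A = mu (A `&` q @^-1` [set j | predT j]).
  by congr (mu _); apply/seteqP; split => t // [].
rewrite fine_content_label// => [|j _]; last first.
  by apply: content_lty_sub fA => //; exact: measurableI.
rewrite fE simple_integral_label// scaler_suml; apply: dvl_ler_sum => j _.
have [[t [At <-]]|Nj] := pselect (exists t, A t /\ q t = j).
  apply: dvl_ler_wpZ; first exact: fine_fibre_ge0.
  by have := fw _ At; rewrite fE.
rewrite fine_fibre_eq0 ?scale0r// => t At; apply/eqP => qt.
by apply: Nj; exists t.
Qed.

End SimpleIntegral.

(** * Integrable functions with values in a vector lattice *)

Section VectorIntegralTheory.
Context d (T : measurableType d) (R : realType) (X : dvlatticeType R).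
Context (lR : convergence (R^o : dvlatticeType R)) (l : convergence X).
Hypothesis hRXX : product_triple lR l l (fun (a : R^o) (x : X) => (a : R) *: x).
Variable mu : {content set T -> \bar R}.
Implicit Types (A B C : set T) (F f g : T -> X) (fs gs : nat -> T -> X).

Lemma measure_conv0_scale (As : nat -> set T) (w : X) :
  measure_conv0 lR mu As -> conv_to l (fun n => fine (mu (As n)) *: w) 0.
Proof. by move=> [_ /(pt_conv0l hRXX w)]. Qed.

Lemma measure_conv0U (As Bs : nat -> set T) :
  (forall n, measurable (As n)) -> (forall n, measurable (Bs n)) ->
  measure_conv0 lR mu As -> measure_conv0 lR mu Bs ->
  measure_conv0 lR mu (fun n => As n `|` Bs n).
Proof.
move=> mA mB [fA cA] [fB cB].
split=> [n|]; first exact: contentU_lty.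
have := convD cA cB; rewrite addr0 => cAB.
apply: conv0_ge0_le cAB _ _ => n; first exact/fine_ge0.
exact: fine_contentU_le.
Qed.

Lemma sup_conv0_le (D : nat -> set X) (b : nat -> X) :
  (forall n, 0 <= b n) -> (forall n x, D n x -> 0 <= x <= b n) ->
  conv_to l b 0 -> sup_conv0 l D.
Proof.
move=> b0 Db cb; have uD n : has_ubound (D n).
  by exists (b n) => x /Db/andP[].
split=> //; apply: conv0_ge0_le cb _ _ => n.
  by apply: supremum_ge0 => // x /Db/andP[].
by apply: supremum_lub => // x /Db/andP[].
Qed.

Lemma conv_simple_integral fs (I : set T -> X) A : measurable A ->
  sup_conv0 l (fun n =>
    [set vabs (simple_integral mu A (fs n) - I A) | A in measurable]) ->
  conv_to l (fun n => simple_integral mu A (fs n)) (I A).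
Proof.
move=> mA [uD cD].
have := convD (conv0_vabs_le cD _) (conv_cst l (I A)).
rewrite add0r; under [in X in _ -> X]eq_fun do
  rewrite -[simple_integral mu A _](subrK (I A)).
by apply=> n; apply: supremum_ub => //; exists A.
Qed.

(** Let [D n] be the union of the exceptional sets of both sequences inside [B]. Over [D n],
    equi-absolute continuity makes the integral small; over the rest, both functions are uniformly
    close to [F], and the integral is at most mu(B) times the sum of the two suprema. *)
Lemma conv_in_measure_integral fs gs F B :
  measurable B -> (mu B < +oo)%E -> defining_seq lR l mu fs F ->
  defining_seq lR l mu gs F ->
  conv_to l (fun n => simple_integral mu B (fun t => vabs (fs n t - gs n t))) 0.
Proof.
move=> mB fB [sf mf [ef _]] [sg mg [eg _]].
have [As [mA cA [uA sA]]] := mf _ mB fB.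
have [As' [mA' cA' [uA' sA']]] := mg _ mB fB.
pose D n := B `&` As n `|` B `&` As' n.
have mBA n : measurable (B `&` As n) by exact: measurableI.
have mBA' n : measurable (B `&` As' n) by exact: measurableI.
have mD n : measurable (D n) by exact: measurableU.
have cD : measure_conv0 lR mu D by exact: measure_conv0U.
have := convD (convD (ef _ mD cD) (eg _ mD cD))
  (convZ (fine (mu B)) (convD sA sA')).
rewrite !addr0 scaler0 addr0 => cb.
have sB n : simple_fun mu (fun t => vabs (fs n t - gs n t)).
  exact/simple_fun_vabs/simple_funB.
apply: conv0_ge0_le cb _ _ => n.
  by apply: simple_integral_ge0 => // t _; exact: vabs_ge0.
rewrite (simple_integral_setID (sB n) mB (mD n)).
have -> : B `&` D n = D n.
  by apply/seteqP; split => [t []//|t [] [? ?]]; split => //; [left|right].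
apply: dvl_lerD; first exact: simple_integral_vabsB_le.
have mBD : measurable (B `\` D n) by exact: measurableD.
have fBD : (mu (B `\` D n) < +oo)%E by apply: content_lty_sub fB => // t [].
set w := _ + _; apply: (@le_trans _ _ (fine (mu (B `\` D n)) *: w)).
  apply: simple_integral_le_cst => // t [Bt /not_orP[nA nA']].
  rewrite (le_trans (ler_vabs_dist (F t) _ _))// (vabs_distC (F t)).
  apply: dvl_lerD; apply: supremum_ub => //; exists t => //; split => // At.
  - by apply: nA.
  - by apply: nA'.
apply: dvl_ler_wZp; first by apply: le_fine_content => // t [].
by apply: dvl_addr_ge0; apply: supremum_ge0 => // x [t _ <-]; exact: vabs_ge0.
Qed.

(* Outside [Bs m `|` Bs' m] the limit superior of the integrals is at most
   [s m + s' m], and inside it the integrals converge to 0. *)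
Lemma defining_seq_conv fs gs F :
  defining_seq lR l mu fs F -> defining_seq lR l mu gs F ->
  conv_to l (fun n => simple_integral mu setT (fun t => vabs (fs n t - gs n t))) 0.
Proof.
move=> df dg; have cint := conv_in_measure_integral _ _ df dg.
case: df => sf _ [_ [Bs [mB _ [s [sB cs]]]]].
case: dg => sg _ [_ [Bs' [mB' _ [s' [sB' cs']]]]].
pose u B n := simple_integral mu B (fun t => vabs (fs n t - gs n t)).
have sfa n := simple_fun_vabs (sf n).
have sga n := simple_fun_vabs (sg n).
have sfg n : simple_fun mu (fun t => vabs (fs n t - gs n t)).
  exact/simple_fun_vabs/simple_funB.
have u0 B : measurable B -> pos_seq (u B).
  by move=> mC n; apply: simple_integral_ge0 => // t _; exact: vabs_ge0.
have uT m : ext_le (climsup l (u setT)) (Fin (s m + s' m)).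
  pose B := Bs m `|` Bs' m.
  have [[mBm fBm] [mBm' fBm']] := (mB m, mB' m).
  have mBU : measurable B by exact: measurableU.
  have mBC := measurableC mBU.
  have fBU : (mu B < +oo)%E by exact: contentU_lty.
  have uE : u setT = fun n => u B n + u (~` B) n.
    apply/funext => n.
    by rewrite /u (simple_integral_setID (sfg n) measurableT mBU) setTI setTD.
  pose v n := simple_integral mu (~` Bs m) (fun t => vabs (fs n t)).
  pose v' n := simple_integral mu (~` Bs' m) (fun t => vabs (gs n t)).
  have v0 : pos_seq v.
    move=> n; apply: simple_integral_ge0 => //; first exact: measurableC.
    by move=> t _; exact: vabs_ge0.
  have v'0 : pos_seq v'.
    move=> n; apply: simple_integral_ge0 => //; first exact: measurableC.
    by move=> t _; exact: vabs_ge0.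
  have vv'0 : pos_seq (fun n => v n + v' n) by move=> n; exact: dvl_addr_ge0.
  have uvv' : ext_le (climsup l (u (~` B))) (climsup l (fun n => v n + v' n)).
    apply: climsup_le => //; first exact: u0.
    near=> n; apply: le_trans (simple_integral_vabsB_le (sf n) (sg n) mBC) _.
    apply: dvl_lerD; apply: le_simple_integral_set => //.
    - exact: measurableC.
    - by apply: subsetC => t; left.
    - by move=> t _; exact: vabs_ge0.
    - exact: measurableC.
    - by apply: subsetC => t; right.
    - by move=> t _; exact: vabs_ge0.
  have [dB eB] := cint _ mBU fBU.
  have := climsup_add l (u0 _ mBU) (u0 _ mBC).
  rewrite -uE (climsup_clim (u0 _ mBU) dB) eB ext_add0 => uTC.
  apply: ext_le_trans uTC (ext_le_trans uvv' _).
  by have := climsup_add l v0 v'0; rewrite (sB m : climsup l v = _)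
    (sB' m : climsup l v' = _).
(* The bound for m = 0 already excludes the value +oo. *)
have [c] : exists c, climsup l (u setT) = Fin c.
  by have := uT 0%N; case: (climsup l _) => // c _; exists c.
move=> uc; have c0 : 0 <= c.
  by have := climsup_ge0 l (u0 _ measurableT); rewrite uc.
have : c <= 0.
  have := convD cs cs'; rewrite addr0 => cv; apply: (conv_to_le (conv_cst l c) cv).
  by move=> n; have := uT n; rewrite uc.
move=> cle; have {cle}c0' : c = 0 by apply/le_anti/andP.
by have := @climsup_eq0 _ _ l _ (u0 _ measurableT); rewrite uc c0' => /(_ erefl).
Unshelve. all: by end_near. Qed.

Lemma is_pos_integral_unique F (I I' : set T -> X) A : measurable A ->
  is_pos_integral lR l mu F I -> is_pos_integral lR l mu F I' -> I A = I' A.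
Proof.
move=> mA [fs [df cf]] [gs [dg cg]].
have [sf sg] : (forall n, simple_fun mu (fs n)) /\ forall n, simple_fun mu (gs n).
  by split; [case: df|case: dg].
have [_ <-] := conv_simple_integral mA cf.
have [_ e] := convB (conv_simple_integral mA cf) (conv_simple_integral mA cg).
have [_ e0] : conv_to l
    (fun n => simple_integral mu A (fs n) - simple_integral mu A (gs n)) 0.
  apply: conv0_vabs_le (defining_seq_conv df dg) _ => n.
  rewrite -simple_integralB//.
  apply: le_trans (vabs_simple_integral_le (simple_funB (sf n) (sg n)) mA) _.
  apply: le_simple_integral_set => //; first exact/simple_fun_vabs/simple_funB.
  by move=> t _; exact: vabs_ge0.
have [_ ->] := conv_simple_integral mA cf.
by apply/eqP; rewrite -subr_eq0 -e e0.
Qed.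

Lemma pos_integralE F (I : set T -> X) A : measurable A ->
  is_pos_integral lR l mu F I -> pos_integral lR l mu A F = I A.
Proof.
move=> mA FI; rewrite /pos_integral; case: xgetP => [v _ [I' FI' ->]|/(_ (I A))].
  exact: is_pos_integral_unique FI' FI.
by case; exists I.
Qed.

(** * Uniform limits of simple functions supported in a set of finite measure *)

Section UniformApproximation.
Variables (F : T -> X) (C : set T) (s : nat -> T -> X) (v w : X).
Hypotheses (mC : measurable C) (fC : (mu C < +oo)%E).
Hypothesis v0 : 0 <= v.
Hypothesis ss : forall n, simple_fun mu (s n).
Hypothesis s_supp : forall n t, ~ C t -> s n t = 0.
Hypothesis s_bnd : forall n t, vabs (s n t) <= w.
Hypothesis s_cvg : forall n t, vabs (F t - s n t) <= n.+1%:R^-1 *: v.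

(** The uniform error v/(n+1), integrated over [C], is k/(n+1). *)
Let k := fine (mu C) *: v.

Let NV0 n : (0 : R) <= n.+1%:R^-1. Proof. by rewrite invr_ge0. Qed.

Lemma simple_integral_support f A : simple_fun mu f -> measurable A ->
  (forall t, ~ C t -> f t = 0) ->
  simple_integral mu A f = simple_integral mu (A `&` C) f.
Proof.
move=> sf mA f0; rewrite (simple_integral_setID sf mA mC).
by rewrite [X in _ + X]simple_integral_eq0 ?addr0// => t [_ /f0].
Qed.

Lemma vabs_simple_integralB_le A n m : measurable A ->
  vabs (simple_integral mu A (s n) - simple_integral mu A (s m)) <=
    n.+1%:R^-1 *: k + m.+1%:R^-1 *: k.
Proof.
move=> mA; rewrite -simple_integralB//.
have ssB := simple_funB (ss n) (ss m); have ssa := simple_fun_vabs ssB.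
apply: le_trans (vabs_simple_integral_le ssB mA) _.
rewrite simple_integral_support//; last first.
  by move=> t Ct; rewrite !s_supp// subrr vabs0.
have mAC : measurable (A `&` C) by exact: measurableI.
apply: (@le_trans _ _ (simple_integral mu C (fun t => vabs (s n t - s m t)))).
  by apply: le_simple_integral_set => // t _; exact: vabs_ge0.
rewrite /k !scalerA ![_^-1 * _]mulrC -!scalerA -scalerDr.
apply: simple_integral_le_cst => // t _.
apply: le_trans (ler_vabs_dist (F t) _ _) _.
by rewrite vabs_distC; apply: dvl_lerD.
Qed.

(** Write J_n for the integral of s_n over A. By the Cauchy estimate every J_n - k/(n+1) lies below
    every J_m + k/(m+1), so the supremum of the former lies within k/(n+1) of each J_n. The error
    does not depend on A, as the definition of the integral requires. *)
Lemma simple_integral_limit : exists I : set T -> X, forall A n, measurable A ->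
  vabs (simple_integral mu A (s n) - I A) <= n.+1%:R^-1 *: k.
Proof.
suff /choice[I HI] : forall A, exists x, forall n, measurable A ->
  vabs (simple_integral mu A (s n) - x) <= n.+1%:R^-1 *: k by exists I.
move=> A; have [mA|nA] := pselect (measurable A); last by exists 0.
pose D := range (fun n => simple_integral mu A (s n) - n.+1%:R^-1 *: k).
have ubD m : ubound D (simple_integral mu A (s m) + m.+1%:R^-1 *: k).
  move=> _ [n _ <-]; have := vabs_simple_integralB_le n m mA.
  rewrite vabs_le !dvl_lerBlDr => /andP[h _].
  by rewrite -addrA addrC [X in X + _]addrC.
have D0 : D !=set0 by eexists; exists 0%N.
have [z [zub zlub]] : supremums D !=set0.
  by apply: dvl_complete; split => //; eexists; exact: ubD 0%N.
exists z => n _; rewrite vabs_le opprB !dvl_lerBlDr ![_ *: k + _]addrC.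
by rewrite -dvl_lerBlDr zub ?zlub//; exists n.
Qed.

(** Convergence in measure holds with empty exceptional sets; the common bound [w] gives absolute
    continuity through the product axiom for null sequences of reals; and [Bs m = C] for all m
    leaves nothing to integrate outside. *)
Lemma uniform_is_pos_integral : exists I, is_pos_integral lR l mu F I /\
  forall A, measurable A -> conv_to l (fun n => simple_integral mu A (s n)) (I A).
Proof.
have [I HI] := simple_integral_limit; exists I.
have cI : sup_conv0 l (fun n =>
    [set vabs (simple_integral mu A (s n) - I A) | A in measurable]).
  apply: (@sup_conv0_le _ (fun n => n.+1%:R^-1 *: k)).
  - move=> n; apply: dvl_scaler_ge0 => //.
    by apply: dvl_scaler_ge0 => //; exact: fine_ge0.
  - by move=> n _ [A mA <-]; rewrite vabs_ge0 HI.
  - exact: conv_harmonic.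
split=> [|A mA]; last exact: conv_simple_integral.
exists s; split=> //; split=> //.
  move=> A mA fA; exists (fun=> set0); split => //.
    split=> [n|]; first by rewrite setI0 measure0.
    under eq_fun do rewrite setI0 measure0.
    exact: conv_cst.
  apply: (@sup_conv0_le _ (fun n => n.+1%:R^-1 *: v)).
  - by move=> n; exact: dvl_scaler_ge0.
  - by move=> n _ [t _ <-]; rewrite vabs_ge0 vabs_distC s_cvg.
  - exact: conv_harmonic.
split=> [As mAs cAs|].
  apply: conv0_ge0_le (measure_conv0_scale w cAs) _ _ => n.
    apply: simple_integral_ge0 => //; first exact: simple_fun_vabs.
    by move=> t _; exact: vabs_ge0.
  apply: simple_integral_le_cst => //; first exact: simple_fun_vabs.
  by have [+ _] := cAs; apply.
exists (fun=> C); split; [by move=> _; split|by move=> _ t|].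
exists (fun=> 0); split; last exact: conv_cst.
move=> m; have -> : (fun n => simple_integral mu (~` C) (fun t => vabs (s n t))) =
    fun=> 0.
  apply/funext => n; apply: simple_integral_eq0 => t Ct.
  by rewrite s_supp// vabs0.
have [d0 e0] := conv_cst l (0 : X).
by rewrite climsup_clim// e0.
Qed.

End UniformApproximation.

Lemma uniform_vintegral F C (s : nat -> T -> X) (v w : X) :
  measurable C -> (mu C < +oo)%E -> 0 <= v ->
  (forall n, simple_fun mu (s n)) -> (forall n t, ~ C t -> s n t = 0) ->
  (forall n t, vabs (s n t) <= w) ->
  (forall n t, vabs (F t - s n t) <= n.+1%:R^-1 *: v) ->
  vintegrable lR l mu F /\ forall A, measurable A ->
    conv_to l (fun n => simple_integral mu A (s n)) (vintegral lR l mu A F).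
Proof.
move=> mC fC v0 ss s_supp s_bnd s_cvg.
(* Used for F and for - F, because [vneg x] is [vpos (- x)] by definition. *)
have pos G (r : nat -> T -> X) : (forall n, simple_fun mu (r n)) ->
    (forall n t, ~ C t -> r n t = 0) -> (forall n t, vabs (r n t) <= w) ->
    (forall n t, vabs (G t - r n t) <= n.+1%:R^-1 *: v) ->
    (exists I, is_pos_integral lR l mu (fun t => vpos (G t)) I) /\
    forall A, measurable A ->
      conv_to l (fun n => simple_integral mu A (fun t => vpos (r n t)))
        (pos_integral lR l mu A (fun t => vpos (G t))).
  move=> sr r_supp r_bnd r_cvg.
  have sp n : simple_fun mu (fun t => vpos (r n t)).
    exact: (simple_fun_map vpos0).
  have p_supp n t : ~ C t -> vpos (r n t) = 0.
    by move=> Ct; rewrite r_supp// vpos0.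
  have p_bnd n t : vabs (vpos (r n t)) <= w.
    rewrite (ger0_vabs (vpos_ge0 _)).
    exact: le_trans (vpos_le_vabs _) (r_bnd n t).
  have p_cvg n t : vabs (vpos (G t) - vpos (r n t)) <= n.+1%:R^-1 *: v.
    exact: le_trans (vpos_dist _ _) (r_cvg n t).
  have [I [GI cI]] := uniform_is_pos_integral mC fC v0 sp p_supp p_bnd p_cvg.
  split=> [|A mA]; first by exists I.
  by rewrite (pos_integralE mA GI); exact: cI.
have [Ip cp] := pos F s ss s_supp s_bnd s_cvg.
have [||||In cn] := pos (fun t => - F t) (fun n t => - s n t).
- by move=> n; apply: (simple_fun_map (op := fun x => - x)) => //; rewrite oppr0.
- by move=> n t Ct; rewrite s_supp// oppr0.
- by move=> n t; rewrite vabsN.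
- by move=> n t; rewrite opprK addrC vabs_distC.
split=> [|A mA]; first by split.
have := convB (cp _ mA) (cn _ mA).
rewrite /vintegral; congr conv_to; apply/funext => n.
rewrite -simple_integralB//.
- by congr simple_integral; apply/funext => t; exact: vposBneg.
- exact: (simple_fun_map vpos0).
- have sN : simple_fun mu (fun t => - s n t).
    by apply: (simple_fun_map (op := fun x => - x)) => //; rewrite oppr0.
  exact: (simple_fun_map vpos0 sN).
Qed.

End VectorIntegralTheory.

(** * Approximation on a compact set *)

Section LebesgueLabel.
Import HBNNSimple.

(* The lemmas of the library on [\int[mu]] ask for a measure; [mu] is only a
   content, so the definition of the integral as a supremum is used directly. *)
Lemma le_lebesgue_label d (T : measurableType d) (R : realType)
    (mu : {content set T -> \bar R}) (J : finType) (q : T -> J) (a : J -> R)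
    (h : T -> R) :
  measurable_label q -> finite_label mu q (a : J -> R^o) ->
  (forall j, 0 <= a j) -> (forall t, a (q t) <= h t) ->
  ((\sum_j fine_fibre mu q setT j * a j)%:E <= \int[mu]_t (h t)%:E)%E.
Proof.
move=> mq fq a0 ah; pose g : T -> R := a \o q.
have mg : isMeasurableFun _ _ T R g.
  split=> _ Y mY; rewrite setTI.
  have := measurable_label_pred [pred j | a j \in Y] mq.
  by congr measurable; apply/seteqP; split => t /=; rewrite inE.
have fg : FiniteImage T R g.
  split; apply: (@sub_finite_set _ _ [set` codom a]) => //.
  by move=> _ [t _ <-]; exact: codom_f.
have ng : isNonNegFun T R g by split=> t; exact: a0.
pose k : {nnsfun T >-> R} := HB.pack_for {nnsfun T >-> R} g mg fg ng.
(* This is [simple_integral_label] for real values, where scaling is multiplication; the sums over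
   values then agree, up to the value 0 and values not attained. *)
have -> : (\sum_j fine_fibre mu q setT j * a j)%:E = sintegral mu k.
  have := simple_integral_label mq fq measurableT => /= <-.
  transitivity (\sum_(x \in range g `\ 0%R) (x%:E * mu (g @^-1` [set x])))%E.
    rewrite /simple_integral -fsumEFin; last first.
      by apply: sub_finite_set (fimfunP k) => x [].
    apply: eq_fsbigr => x; rewrite inE => -[_ /eqP x0].
    rewrite setTI [RHS]muleC EFinM fineK//; apply: content_fin_num.
    have -> : g @^-1` [set x] = setT `&` q @^-1` [set j | a j == x].
      by rewrite setTI; apply/seteqP; split => t /eqP.
    rewrite content_label// lte_sum_pinfty// => j /eqP aj.
    by rewrite setTI; apply: fq; rewrite aj.
  apply: fsbig_widen => // x [_ /= Nx].
  change (x%:E * mu (g @^-1` [set x]) = 0)%E.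
  have [->|x0] := eqVneq x 0; first by rewrite mul0e.
  rewrite preimage10 ?measure0 ?mule0// => gx.
  by apply: Nx; split => //; exact/eqP.
rewrite /integral -[X in (X <= _)%E]sube0.
apply: leeB.
  apply: ereal_sup_ubound => /=; exists k => //= t.
  rewrite (@ge0_funeposE _ _ setT) ?in_setT// => [|x _]; rewrite patchT ?in_setT//.
    by rewrite lee_fin ah.
  by rewrite lee_fin (le_trans (a0 (q x))).
(* As [h] is nonnegative, its negative part is 0, and the only nonnegative simple function below it
   is 0. *)
apply: ge_ereal_sup => _ [r /= rh <-].
rewrite /sintegral fsbig1// => x _; have [->|x0] := eqVneq x 0.
  by rewrite mul0e.
rewrite preimage10 ?measure0 ?mule0// => -[t _ rx].
have := rh t; rewrite (@ge0_funenegE _ _ setT) ?in_setT// => [|y _]; last first.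
  by rewrite patchT ?in_setT// lee_fin (le_trans (a0 (q y))).
rewrite lee_fin => rt0; move/eqP: x0; apply; rewrite -rx.
by apply/le_anti; rewrite rt0 fun_ge0.
Qed.

End LebesgueLabel.

(** * Measurable finite nets and step functions *)

Section BorelApproximation.
Variables (R : realType) (G : pmetricType R).

Lemma measurable_open (U : set (borel G)) : @open G U -> measurable U.
Proof. exact: sub_sigma_algebra. Qed.

Lemma compact_measurable (C : set G) : compact C -> measurable (C : set (borel G)).
Proof.
move=> cC; rewrite -[C]setCK; apply: measurableC; apply: measurable_open.
apply: closed_openC; apply: compact_closed => //; exact: metric_hausdorff.
Qed.

(** A finite subcover by interiors of balls, which are Borel, provides the label; the chosen point
    is the centre of any ball containing [t]. The default [point] belongs to the label of points
    that no ball covers, hence outside [C]. *)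
Lemma compact_net (C : set G) (e : R) : compact C -> 0 < e ->
  exists (J : finType) (q : borel G -> J) (x : J -> G),
    measurable_label q /\ forall t, C t -> mdist (x (q t)) t < e.
Proof.
rewrite compact_cover => cC e0.
have [|t Ct|D _ CD] := cC _ setT (fun x : G => (ball x e)°%classic).
- by move=> i _; exact: open_interior.
- by exists t => //; exact: nbhsx_ballx.
pose s : seq G := finmap.enum_fset D.
pose A (i : 'I_(size s)) : set (borel G) := (ball (nth point s i) e)°%classic.
exists {ffun 'I_(size s) -> bool}, (fun t => [ffun i => t \in A i]).
exists (fun b : {ffun 'I_(size s) -> bool} =>
  if [pick i | b i] is Some i then nth point s i else point).
split=> [|t Ct].
  by apply: measurable_label_sets => i; apply: measurable_open; exact: open_interior.
case: pickP => [i|].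
  rewrite ffunE => /set_mem /interior_subset; rewrite ballEmdist; exact.
have [x /= xD tx] := CD _ Ct.
have xs : (index x s < size s)%N by rewrite index_mem.
have At : A (Ordinal xs) t by rewrite /A /= nth_index.
by move=> /(_ (Ordinal xs)); rewrite ffunE (mem_set At).
Qed.

End BorelApproximation.

(** [g] counts the integers from 1 to K that are at most x: it is the integer part of x capped at K,
    and the cap matters only at x = K + 1. *)
Lemma step_below (R : realType) (x : R) (K : nat) : 0 <= x -> x <= K.+1%:R ->
  let g := \sum_(i < K) (i.+1%:R <= x)%R%:R in g <= x <= g + 1.
Proof.
move=> x0; elim: K => [|K IH] xK /=; first by rewrite big_ord0 x0 add0r.
rewrite big_ord_recr/=; have [Kx|xK'] := lerP K.+1%:R x; last first.
  by rewrite addr0; exact/IH/ltW.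
rewrite (eq_bigr (fun=> 1)) => [|i _]; last first.
  by rewrite (le_trans _ Kx)// ler_nat ltnS ltnW.
by rewrite sumr_const card_ord mulr1n !natr1 Kx.
Qed.

(** (n+1)h is rounded down to an integer by counting the level sets h >= i/(n+1) that contain the
    point; cutting them with [C] makes the step function vanish elsewhere. *)
Lemma step_label d (T : measurableType d) (R : realType) (C : set T) (h : T -> R)
    (M : R) (n : nat) :
  measurable C -> measurable_fun setT h -> (forall t, 0 <= h t) ->
  (forall t, C t -> h t <= M) ->
  exists (J : finType) (q : T -> J) (a : J -> R),
    [/\ measurable_label q, forall j, 0 <= a j, forall t, ~ C t -> a (q t) = 0 &
        forall t, C t -> a (q t) <= h t <= a (q t) + n.+1%:R^-1].
Proof.
move=> mC mh h0 hM; have N0 : (0 : R) < n.+1%:R by rewrite ltr0n.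
(* [M] may be negative when [C] is empty. *)
pose K := Num.trunc (n.+1%:R * Num.max M 0).
pose A (i : 'I_K) := C `&` h @^-1` `[i.+1%:R / n.+1%:R, +oo[%classic.
exists {ffun 'I_K -> bool}, (fun t => [ffun i => t \in A i]).
exists (fun b : {ffun 'I_K -> bool} => (\sum_i (b i)%:R) / n.+1%:R); split.
- apply: measurable_label_sets => i; apply: measurableI => //.
  by rewrite -[X in measurable X]setTI; exact: mh.
- by move=> b; rewrite divr_ge0// sumr_ge0.
- move=> t Ct; rewrite big1 ?mul0r// => i _.
  by rewrite ffunE memNset// => -[].
- move=> t Ct.
  have x0 : 0 <= n.+1%:R * h t by rewrite mulr_ge0.
  have xK : n.+1%:R * h t <= K.+1%:R.
    have M0 : 0 <= n.+1%:R * Num.max M 0 by rewrite mulr_ge0// le_max lexx orbT.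
    have /andP[_ /ltW] := truncn_itv M0; apply: le_trans.
    by rewrite ler_pM2l// le_max hM.
  have := step_below x0 xK => /=.
  rewrite (eq_bigr (fun i : 'I_K => ([ffun i => t \in A i] i)%:R)) => [|i _].
    move=> /andP[gx xg]; rewrite ler_pdivrMr// mulrC gx/=.
    by rewrite -[X in _ <= _ + X]mul1r -mulrDl ler_pdivlMr// mulrC.
  rewrite ffunE; congr (_%:R); congr nat_of_bool.
  apply/idP/idP => [it|/set_mem[_ /=]].
    apply/mem_set; split => //=.
    by rewrite in_itv /= andbT ler_pdivrMr// mulrC.
  by rewrite in_itv /= andbT ler_pdivrMr// mulrC.
Qed.

(** * Jensen's inequality *)

Section VectorJensen.
Context (R : realType) (X : dvlatticeType R) (l : convergence X).
Context (mul : X -> X -> X) (hmul : product_triple l l l mul).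
Variables (phi beta : X -> X).
Hypothesis phi0 : phi 0 = 0.
Hypothesis subgradient : forall v s, phi v + mul (beta v) (s - v) <= phi s.

(** Summing the weighted subgradient inequalities produces the affine part phi(v) - beta_v v with
    the factor [a], the total weight. This part is at most 0, by the inequality at s = 0, so raising
    the factor from [a] to 1 only lowers the bound. *)
Lemma finite_jensen (J : finType) (p : J -> R) (x : J -> X) (v : X) :
  (forall j, 0 <= p j) -> \sum_j p j <= 1 ->
  phi v + mul (beta v) (\sum_j p j *: x j - v) <= \sum_j p j *: phi (x j).
Proof.
move=> p0 p1; set a := \sum_j p j in p1.
apply: (@le_trans _ _ (\sum_j p j *: (phi v + mul (beta v) (x j - v)))); last first.
  by apply: dvl_ler_sum => j _; exact: dvl_ler_wpZ.
have -> : \sum_j p j *: (phi v + mul (beta v) (x j - v)) =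
    a *: (phi v - mul (beta v) v) + \sum_j p j *: mul (beta v) (x j).
  rewrite scaler_suml -big_split; apply: eq_bigr => j _ /=.
  by rewrite -scalerDr (mulvB hmul) addrAC addrA.
rewrite (mulvB hmul) (mulv_sum hmul).
set B := mul _ v; set S := \sum_j _.
have pvB : phi v <= B.
  have := subgradient v 0; rewrite phi0 sub0r (mulvN hmul) -/B.
  by rewrite dvl_lerBlDr add0r.
rewrite addrCA addrC; apply: dvl_lerD2r.
rewrite -dvl_subr_ge0 -[X in _ - X]scale1r -scalerBl -opprB scaleNr -scalerN opprB.
by apply: dvl_scaler_ge0; rewrite ?subr_ge0 ?dvl_subr_ge0.
Qed.

(** The subgradient at v bounds phi(v) - phi(s) by beta_v (v - s), hence by b|v - s|; the
    subgradient at s gives the other sign. *)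
Lemma lipschitz_on_interval (w b : X) :
  (forall v, vabs v <= w -> vabs (beta v) <= b) ->
  forall v s, vabs v <= w -> vabs s <= w ->
    vabs (phi v - phi s) <= mul b (vabs (v - s)).
Proof.
move=> bP v s vw sw.
have H v' s' : vabs v' <= w -> phi v' - phi s' <= mul b (vabs (v' - s')).
  move=> v'w; apply: le_trans _ (mulv_vabs_le hmul _ (bP _ v'w)).
  rewrite dvl_lerBlDr addrC -dvl_lerBlDr -(mulvN hmul) opprB.
  exact: subgradient.
by rewrite vabs_le H// opprB vabs_distC H.
Qed.

End VectorJensen.

(** Convexity speaks of intervals with u nonzero; for w = 0 the interval is the single point 0 and
    is treated apart. *)
Lemma order_bounded_vabs (R : realType) (X : dvlatticeType R) (beta : X -> X) :
  (forall u, 0 <= u -> u != 0 ->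
    order_bounded [set beta v | v in [set v | - u <= v <= u]]) ->
  forall w, 0 <= w -> exists b, forall v, vabs v <= w -> vabs (beta v) <= b.
Proof.
move=> ob w w0; have [->|wN0] := eqVneq w 0.
  exists (vabs (beta 0)) => v v0.
  suff -> : v = 0 by [].
  apply/le_anti; rewrite (le_trans (ler_vabs _) v0) -dvl_lerN2 oppr0.
  exact: le_trans (lerN_vabs _) v0.
have [[M uM] [L lL]] := ob _ w0 wN0; exists (vabs M + vabs L) => v vw.
have bv : [set beta v | v in [set v | - w <= v <= w]] (beta v).
  by exists v => //=; rewrite ler_norm_vabs.
rewrite vabs_le; apply/andP; split.
  rewrite -[X in X <= _]addr0; apply: dvl_lerD (vabs_ge0 _).
  exact: le_trans (uM _ bv) (ler_vabs _).
rewrite -[X in X <= _]add0r; apply: dvl_lerD (vabs_ge0 _) _.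
by apply: le_trans (lerN_vabs L); rewrite dvl_lerN2; exact: lL.
Qed.

(** From cx - ay = (c - a)y + c(x - y), whose terms account for [w] and [M *: u]. Here c is a value
    of [h], a its step, x a value of the function and y the value at the net point. *)
Lemma vabs_scaleB_le (R : realType) (X : dvlatticeType R) (a c e M : R)
    (x y u w : X) :
  0 <= a -> a <= c <= a + e -> c <= M -> vabs y <= w -> vabs (x - y) <= e *: u ->
  vabs (c *: x - a *: y) <= e *: (w + M *: u).
Proof.
move=> a0 /andP[ac cae] cM yw xyu; have c0 := le_trans a0 ac.
have -> : c *: x - a *: y = (c - a) *: y + c *: (x - y).
  by rewrite scalerBl scalerBr [RHS]addrC addrA subrK.
have w0 := le_trans (vabs_ge0 _) yw.
have ca0 : 0 <= c - a by rewrite subr_ge0.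
apply: le_trans (ler_vabsD _ _) _.
rewrite [X in _ <= X]scalerDr; apply: dvl_lerD.
  apply: le_trans (ler_vabsZ _ _) _; rewrite ger0_norm//.
  apply: le_trans (dvl_ler_wpZ ca0 yw) _; apply: dvl_ler_wZp => //.
  by rewrite lerBlDl.
apply: le_trans (ler_vabsZ _ _) _; rewrite ger0_norm//.
apply: le_trans (dvl_ler_wpZ c0 xyu) _.
rewrite [X in _ <= X]scalerA mulrC -scalerA; apply: dvl_ler_wZp => //.
exact: le_trans (vabs_ge0 _) xyu.
Qed.

(** On [C], f stays within [u] of finitely many values at net points, and the sum of their moduli
    dominates each of them. *)
Lemma vunif_continuous_bounded (R : realType) (G : pmetricType R)
    (X : dvlatticeType R) (C : set G) (f : G -> X) :
  compact C -> (forall g, ~ C g -> f g = 0) -> vunif_continuous f ->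
  exists2 w, 0 <= w & forall g, vabs (f g) <= w.
Proof.
move=> cC f0 [u u0 /(_ 1 ltr01)[e e0 fu]].
have [J [q [x [_ xq]]]] := compact_net cC e0.
pose S : X := \sum_j vabs (f (x j)).
have S0 : 0 <= S.
  by apply: dvl_sumr_ge0 => j _; exact: vabs_ge0.
exists (u + S) => [|g]; first exact: dvl_addr_ge0.
have [Cg|/f0 ->] := pselect (C g); last by rewrite vabs0 dvl_addr_ge0.
rewrite -[f g](subrK (f (x (q g)))); apply: le_trans (ler_vabsD _ _) _.
rewrite vabs_distC.
apply: dvl_lerD; first by rewrite -[u]scale1r fu// ltW// xq.
rewrite /S (bigD1 (q g))//= -[X in X <= _]addr0 dvl_lerD2l//.
by apply: dvl_sumr_ge0 => j _; exact: vabs_ge0.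
Qed.

(** It supplies what [uniform_vintegral] asks of both approximating sequences, with the finite
    inequality as last clause. One tolerance 1/(n+1) governs the net and the steps, and [phif_uc]
    passes it from f to phi(f) on the same net. *)
Lemma jensen_approximation (R : realType) (X : dvlatticeType R)
    (l : convergence X) (mul : X -> X -> X) (hmul : product_triple l l l mul)
    (phi beta : X -> X) (phi0 : phi 0 = 0)
    (subgradient : forall v s, phi v + mul (beta v) (s - v) <= phi s)
    (G : pmetricType R) (C : set G) (cC : compact C)
    (mu : {content set (borel G) -> \bar R}) (fC : (mu C < +oo)%E)
    (f : G -> X) (u w u' w' : X) (u0 : 0 <= u) (u'0 : 0 <= u')
    (f_uc : forall e : R, 0 < e -> exists2 delta : R, 0 < delta &
       forall g1 g2 : G, mdist g1 g2 <= delta -> vabs (f g1 - f g2) <= e *: u)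
    (f_supp : forall g, ~ C g -> f g = 0) (f_bnd : forall g, vabs (f g) <= w)
    (phif_bnd : forall g, vabs (phi (f g)) <= w')
    (phif_uc : forall (e : R) g1 g2, vabs (f g1 - f g2) <= e *: u ->
       vabs (phi (f g1) - phi (f g2)) <= e *: u')
    (h : G -> R) (h_ge0 : forall g, 0 <= h g)
    (h_meas : measurable_fun [set: borel G] (h : borel G -> R))
    (M : R) (M0 : 0 <= M) (h_bnd : forall g, C g -> h g <= M)
    (h_mass : (\int[mu]_(g in [set: borel G]) (h g)%:E <= 1)%E) (n : nat) :
  exists ss : (borel G -> X) * (borel G -> X),
    [/\ simple_fun mu ss.1 /\ simple_fun mu ss.2,
        forall t, ~ C t -> ss.1 t = 0 /\ ss.2 t = 0,
        forall t, vabs (ss.1 t) <= M *: w /\ vabs (ss.2 t) <= M *: w',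
        forall t, vabs (h t *: f t - ss.1 t) <= n.+1%:R^-1 *: (w + M *: u) /\
          vabs (h t *: phi (f t) - ss.2 t) <= n.+1%:R^-1 *: (w' + M *: u') &
        forall v, phi v + mul (beta v) (simple_integral mu setT ss.1 - v) <=
          simple_integral mu setT ss.2].
Proof.
have e0 : (0 : R) < n.+1%:R^-1 by rewrite invr_gt0 ltr0n.
have [delta delta0 fd] := f_uc _ e0.
have mC := compact_measurable cC.
have [J [q [x [mq xq]]]] := compact_net cC delta0.
have [K [p [a [mp a0 aC ah]]]] := step_label n mC h_meas h_ge0 h_bnd.
pose lbl (t : borel G) : J * K := (q t, p t).
have mlbl : measurable_label lbl by exact: measurable_label_pair.
(* A cell with nonzero step lies inside [C]. *)
have fibre_lty j : a j.2 != 0 -> (mu (lbl @^-1` [set j]) < +oo)%E.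
  move=> aj; apply: content_lty_sub fC => // t lt.
  by apply: contrapT => /aC pt; move: aj; rewrite -lt /= pt eqxx.
have ac t : a (p t) <= h t.
  have [Ct|/aC ->//] := pselect (C t).
  by have /andP[] := ah _ Ct.
have aM t : a (p t) <= M.
  have [Ct|/aC ->//] := pselect (C t); exact: le_trans (ac t) (h_bnd _ Ct).
(* [psi] will be the identity and [phi]. The net point [x j.1] may lie outside [C], where f is still
   controlled by uniform continuity on G. *)
pose s (psi : X -> X) (j : J * K) := a j.2 *: psi (f (x j.1)).
have fs psi : finite_label mu lbl (s psi).
  move=> j; rewrite /s => sj; apply: fibre_lty.
  by apply: contra_neq sj => ->; rewrite scale0r.
have s_bnd psi z : (forall g, vabs (psi (f g)) <= z) ->
    forall t, vabs (s psi (lbl t)) <= M *: z.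
  move=> pz t; rewrite /s.
  apply: le_trans (ler_vabsZ _ _) _; rewrite ger0_norm//.
  apply: le_trans (dvl_ler_wpZ (a0 _) (pz _)) _; apply: dvl_ler_wZp; first exact: aM.
  exact: le_trans (vabs_ge0 _) (pz t).
have s_cvg psi y z : 0 <= y -> psi 0 = 0 -> (forall g, vabs (psi (f g)) <= z) ->
    (forall g1 g2, vabs (f g1 - f g2) <= n.+1%:R^-1 *: u ->
       vabs (psi (f g1) - psi (f g2)) <= n.+1%:R^-1 *: y) ->
    forall t, vabs (h t *: psi (f t) - s psi (lbl t)) <=
      n.+1%:R^-1 *: (z + M *: y).
  move=> y0 psi0 pz py t; have [Ct|Ct] := pselect (C t).
    apply: vabs_scaleB_le (ah _ Ct) (h_bnd _ Ct) (pz _) _ => //.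
    by apply: py; rewrite vabs_distC fd// ltW// xq.
  rewrite /s f_supp// psi0 scaler0 aC// scale0r subrr vabs0.
  have z0 : 0 <= z by exact: le_trans (vabs_ge0 _) (pz t).
  apply: dvl_scaler_ge0; first exact: ltW.
  by apply: dvl_addr_ge0 => //; exact: dvl_scaler_ge0.
exists (s id \o lbl, s phi \o lbl); split => /=.
- by split; apply/simple_funP; exists (J * K)%type, lbl; eexists.
- by move=> t Ct; rewrite /s /= aC// !scale0r.
- by move=> t; split; exact: s_bnd.
- by move=> t; split; [apply: (s_cvg id)|apply: s_cvg => // g1 g2; exact: phif_uc].
- move=> v; rewrite !simple_integral_label//.
  rewrite /s; under eq_bigr do rewrite scalerA.
  under [X in _ <= X]eq_bigr do rewrite scalerA.
  apply: (finite_jensen hmul phi0 subgradient) => [j|].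
    by rewrite mulr_ge0 ?fine_fibre_ge0.
  (* The total weight is the integral of the step function, which lies below [h] everywhere. *)
  rewrite -lee_fin; apply: le_trans h_mass.
  exact: (le_lebesgue_label mlbl (a := fun j => a j.2)).
Qed.

Theorem corollary3p27 (R : realType) (X : dvlatticeType R)
    (lR : convergence (R^o : dvlatticeType R)) (l : convergence X)
    (mul : X -> X -> X)
    (hXXX : product_triple l l l mul)
    (hRXX : product_triple lR l l (fun (a : R^o) (x : X) => (a : R) *: x))
    (hXRX : product_triple l lR l (fun (x : X) (a : R^o) => (a : R) *: x))
    (G : pmetricType R) (C : set G) (hC : compact C)
    (mu : {content set (borel G) -> \bar R})
    (mu_sfin : sigma_finite [set: borel G] mu)
    (mu_reg : regular_measure mu)
    (phi : X -> X) (phi_convex : vconvex mul phi) (phi0 : phi 0 = 0)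
    (f : G -> X) (f_uc : vunif_continuous f)
    (f_supp : forall g, ~ C g -> f g = 0)
    (h : G -> R) (h_ge0 : forall g, 0 <= h g)
    (h_int : mu.-integrable [set: borel G] (fun g : borel G => (h g)%:E))
    (h_bnd : forall B : set (borel G), measurable B -> (mu B < +oo)%E ->
       exists M : R, forall g, B g -> h g <= M)
    (h_mass_gt0 : (0 < \int[mu]_(g in [set: borel G]) (h g)%:E)%E)
    (h_mass_le1 : (\int[mu]_(g in [set: borel G]) (h g)%:E <= 1)%E) :
  [/\ vintegrable lR l mu (fun g : borel G => h g *: f g),
      vintegrable lR l mu (fun g : borel G => h g *: phi (f g)) &
      phi (vintegral lR l mu [set: borel G] (fun g => h g *: f g))
        <= vintegral lR l mu [set: borel G] (fun g => h g *: phi (f g))].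
Proof.
have [beta [subgradient beta_bnd]] := phi_convex.
have mC := compact_measurable hC.
have fC : (mu C < +oo)%E by exact: mu_reg.1.
have [w w0 f_bnd] := vunif_continuous_bounded hC f_supp f_uc.
have [u u0 fu] := f_uc.
have [b bP] := order_bounded_vabs beta_bnd w0.
have b0 : 0 <= b.
  by apply: le_trans (vabs_ge0 (beta 0)) (bP _ _); rewrite vabs0.
have lip := lipschitz_on_interval hXXX subgradient bP.
(* The Lipschitz estimate against the point 0, where phi vanishes. *)
have phif_bnd g : vabs (phi (f g)) <= mul b w.
  rewrite -[phi _]subr0 -phi0; apply: le_trans (lip _ _ (f_bnd g) _) _.
    by rewrite vabs0.
  by rewrite subr0; exact: (pt_le2l hXXX).
have phif_uc (e : R) g1 g2 : vabs (f g1 - f g2) <= e *: u ->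
    vabs (phi (f g1) - phi (f g2)) <= e *: mul b u.
  move=> fe; apply: le_trans (lip _ _ (f_bnd g1) (f_bnd g2)) _.
  by rewrite -(mulvZ hXXX); exact: (pt_le2l hXXX).
have [M0 M0P] := h_bnd _ mC fC.
pose M := Num.max M0 0.
have M_ge0 : 0 <= M by rewrite le_max lexx orbT.
have MP g : C g -> h g <= M by move=> /M0P hg; rewrite le_max hg.
have h_meas : measurable_fun [set: borel G] (h : borel G -> R).
  by case/integrableP: h_int => /measurable_realfun.measurable_EFinP.
have w'0 := mulv_ge0 hXXX b0 w0.
have u'0 := mulv_ge0 hXXX b0 u0.
have /choice[ss ssP] := jensen_approximation hXXX phi0 subgradient hC fC u0 u'0 fu
  f_supp f_bnd phif_bnd phif_uc h_ge0 h_meas M_ge0 MP h_mass_le1.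
have [|||||hf_int hf_cvg] := uniform_vintegral hRXX (mu := mu)
  (F := fun g : borel G => h g *: f g) (C := C) (s := fun n => (ss n).1)
  (v := w + M *: u) (w := M *: w) mC fC.
- by apply: dvl_addr_ge0 => //; exact: dvl_scaler_ge0.
- by move=> n; have [[]] := ssP n.
- by move=> n t Ct; have [_ /(_ t Ct)[]] := ssP n.
- by move=> n t; have [_ _ /(_ t)[]] := ssP n.
- by move=> n t; have [_ _ _ /(_ t)[]] := ssP n.
have [|||||phif_int phif_cvg] := uniform_vintegral hRXX (mu := mu)
  (F := fun g : borel G => h g *: phi (f g)) (C := C) (s := fun n => (ss n).2)
  (v := mul b w + M *: mul b u) (w := M *: mul b w) mC fC.
- by apply: dvl_addr_ge0 => //; exact: dvl_scaler_ge0.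
- by move=> n; have [[]] := ssP n.
- by move=> n t Ct; have [_ /(_ t Ct)[]] := ssP n.
- by move=> n t; have [_ _ /(_ t)[]] := ssP n.
- by move=> n t; have [_ _ _ /(_ t)[]] := ssP n.
split=> //; set V := vintegral _ _ _ _ _.
(* The errors of the integrals form a null sequence, which the product with the fixed [beta V]
   preserves; hence the left-hand sides converge to [phi V]. *)
have cV := convB (hf_cvg _ measurableT) (conv_cst l V).
rewrite subrr in cV.
have := convD (conv_cst l (phi V)) (pt_conv0r hXXX (beta V) cV).
rewrite addr0 => /conv_to_le/(_ (phif_cvg _ measurableT)); apply=> n.
by have [] := ssP n.
Qed.
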